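(* Let $(H_0,H_1,H_2)$ be a Hilbert space triple and let $s\in[0,1)$. Let $U_1,V_1,W_1\subset H_1$ be open subsets and let $\phi\colon U_1\to V_1$ and $\psi\colon V_1\to W_1$ be $s$-Floer maps. Then the composition $\psi\circ\phi\colon U_1\to W_1$ is an $s$-Floer map.
   Context: **Spaces.** $\mathcal{L}(X,Y)$ denotes bounded linear maps with the operator norm, $\mathcal{L}(X)=\mathcal{L}(X,X)$, and $\mathcal{L}(X,Y;Z)$ denotes bounded bilinear maps $X\times Y\to Z$ with its norm. A Hilbert space triple $(H_0,H_1,H_2)$ consists of real Hilbert spaces $H_2\subset H_1\subset H_0$ such that both inclusions are dense and compact. $\langle\cdot,\cdot\rangle_0$ is the inner product of $H_0$. $H_{-1}$ is the completion of $H_0$ in the norm $\|\eta\|_{-1}=\sup_{0\ne\xi\in H_1}|\langle\eta,\xi\rangle_0|/\|\xi\|_1$. For $s\in[0,1]$, $H_s$ is the Hilbert interpolation space between $H_0$ and $H_1$: if $\Lambda$ is the positive self-adjoint operator on $H_0$ with domain $H_1$ and $\|\Lambda\xi\|_0=\|\xi\|_1$, then $H_s=\mathrm{dom}(\Lambda^s)$ with norm $\|\Lambda^s\xi\|_0$. Likewise $H_{1+s}$ is the corresponding interpolation space between $H_1$ and $H_2$. For an open subset $U_1\subset H_1$ put $U_2:=U_1\cap H_2$, an open subset of $H_2$. **Floer map.** Let $s\in[0,1)$ and let $U_1,V_1\subset H_1$ be open. A map $\phi\colon U_1\to V_1$ is two-level $\mathrm{ssc}^2$ if $\phi$ is $C^2$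 (in the $H_1$-topology), $\phi(U_2)\subset V_2$, and the restriction $\phi_2\colon U_2\to V_2$ is $C^2$ in the $H_2$-topology. A two-level $\mathrm{ssc}^2$ map $\phi\colon U_1\to V_1$ is an $s$-Floer map if: (i)$_1$ For every $q\in U_1$ the derivative $d\phi|_q\in\mathcal{L}(H_1)$ extends to some $D\phi|_q\in\mathcal{L}(H_0)$, and $U_1\to\mathcal{L}(H_0)$, $q\mapsto D\phi|_q$, is $C^1$. (i)$_2$ For every $q\in U_2$ the operator $D\phi|_q\in\mathcal{L}(H_0)$ extends further to an element of $\mathcal{L}(H_{-1})$, still denoted $D\phi|_q$, and $U_2\to\mathcal{L}(H_{-1})$, $q\mapsto D\phi|_q$, is $C^1$. (ii)$_1$ For every $q\in U_1$ the second derivative $d^2\phi|_q\in\mathcal{L}(H_1,H_1;H_1)$ extends to some $D^2\phi|_q\in\mathcal{L}(H_s,H_0;H_0)$, and $U_1\to\mathcal{L}(H_s,H_0;H_0)$, $q\mapsto D^2\phi|_q$, is continuous. (ii)$_2$ For every $q\in U_2$ the restriction of $D^2\phi|_q$ to $H_{1+s}\times H_0$ extends to an element of $\mathcal{L}(H_{1+s},H_{-1};H_{-1})$, still denoted $D^2\phi|_q$, and $U_2\to\mathcal{L}(H_{1+s},H_{-1};H_{-1})$, $q\mapsto D^2\phi|_q$, is continuous. *)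

(* Defs.v *)
From HB Require Import structures.
From mathcomp Require Import all_boot all_order all_algebra.
From mathcomp Require Import all_classical all_reals all_analysis.

Set Implicit Arguments.
Unset Strict Implicit.
Unset Printing Implicit Defensive.
Import Order.TTheory GRing.Theory Num.Theory.
Import numFieldNormedType.Exports.
Local Open Scope classical_set_scope.
Local Open Scope ring_scope.

HB.mixin Record CompleteNormedModule_isHilbert (R : realType) H
    & CompleteNormedModule R H := {
  dotp : H -> H -> R;
  dotpC : forall x y, dotp x y = dotp y x;
  dotp_linear : forall a x y z,
    dotp (a *: x + y) z = a * dotp x z + dotp y z;
  dotp_norm : forall x, dotp x x = `|x| ^+ 2
}.

#[short(type="hilbertType")]
HB.structure Definition Hilbert (R : realType) :=
  {H of CompleteNormedModule R H & CompleteNormedModule_isHilbert R H}.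

(* bop g Y is the space of linear maps f : X -> Y that are bounded with respect
   to a gauge g on X, i.e. `|f x| <= C * g x, normed by the least such C.
   For g the norm of X this is L(X, Y) with the operator norm. Leaving g
   arbitrary allows X to be a Hilbert interpolation space, where g is
   |Lambda^s x|, without first having to show that g is a norm. *)
Section BoundedOperators.
Context (R : realType) (X : lmodType R) (g : X -> R) (Y : normedModType R).

Definition op_bound (f : X -> Y) (C : R) : Prop :=
  0 <= C /\ forall x, `|f x| <= C * g x.

Definition bop_pred : {pred X -> Y} :=
  fun f => `[< linear f /\ exists C, op_bound f C >].

Lemma bop_submod_closed : submod_closed bop_pred.
Proof.
split=> [|a f h /asboolP[lf [C [C0 fC]]] /asboolP[lh [D [D0 hD]]]].
  apply/asboolP; split; first by move=> a x y /=; rewrite scaler0 addr0.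
  by exists 0; split=> // x; rewrite normr0 mul0r.
apply/asboolP; split.
  move=> b x y; rewrite !fctE lf lh /= !scalerDr !scalerA (mulrC a b).
  by rewrite addrACA.
exists (`|a| * C + D); split; first by rewrite addr_ge0// mulr_ge0.
move=> x; rewrite !fctE (le_trans (ler_normD _ _))// mulrDl lerD//.
by rewrite normrZ -mulrA ler_wpM2l.
Qed.

HB.instance Definition _ :=
  GRing.isSubmodClosed.Build R (X -> Y) bop_pred bop_submod_closed.

Record bop := Bop { bop_fun :> X -> Y; _ : bop_fun \in bop_pred }.

HB.instance Definition _ := [isSub for bop_fun].
HB.instance Definition _ := [Choice of bop by <:].
HB.instance Definition _ := [SubChoice_isSubLmodule of bop by <:].

Lemma bop_is_linear (f : bop) : linear f.
Proof. by have /asboolP[] := valP f. Qed.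

HB.instance Definition _ (f : bop) :=
  GRing.isLinear.Build R X Y *:%R f (@bop_is_linear f).

Definition opnorm (f : bop) : R := inf [set C | op_bound f C].

Let has_inf_bound (f : bop) : has_inf [set C | op_bound f C].
Proof.
split; first by have /asboolP[_ [C fC]] := valP f; exists C.
by exists 0 => C [].
Qed.

Lemma opnorm_ge0 (f : bop) : 0 <= opnorm f.
Proof. by apply: lb_le_inf; [case: (has_inf_bound f)|move=> C []]. Qed.

Lemma opnorm_le (f : bop) C : op_bound f C -> opnorm f <= C.
Proof. by apply: ge_inf; case: (has_inf_bound f). Qed.

Lemma le_opnorm (f : bop) x : `|f x| <= opnorm f * g x.
Proof.
have [[C [C0 fC]] _] := has_inf_bound f.
have [g0|g0] := ltP 0 (g x).
  rewrite -ler_pdivrMr//; apply: lb_le_inf; first by exists C.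
  by move=> D [_ fD]; rewrite ler_pdivrMr.
have fx0 : `|f x| <= 0 by rewrite (le_trans (fC x))// mulr_ge0_le0.
have [gx0|gx_neq0] := eqVneq (g x) 0; first by rewrite gx0 mulr0.
have C_eq0 : C <= 0.
  rewrite leNgt; apply/negP => Cpos.
  have := le_trans (normr_ge0 _) (fC x).
  by rewrite pmulr_rge0// leNgt lt_neqAle gx_neq0 g0.
have f0 : opnorm f <= C by apply: opnorm_le; split.
have -> : opnorm f = 0.
  by apply/eqP; rewrite eq_le opnorm_ge0 (le_trans f0 C_eq0).
by rewrite mul0r.
Qed.

Lemma op_bound_opnorm (f : bop) : op_bound f (opnorm f).
Proof. by split; [exact: opnorm_ge0|exact: le_opnorm]. Qed.

Lemma opnormD (f h : bop) : opnorm (f + h) <= opnorm f + opnorm h.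
Proof.
apply: opnorm_le; split; first by rewrite addr_ge0 ?opnorm_ge0.
move=> x; rewrite (_ : (f + h : bop) x = f x + h x)//.
by rewrite (le_trans (ler_normD _ _))// mulrDl lerD// le_opnorm.
Qed.

Let opnormZ_le a (f : bop) : opnorm (a *: f) <= `|a| * opnorm f.
Proof.
apply: opnorm_le; split; first by rewrite mulr_ge0 ?opnorm_ge0.
move=> x; rewrite (_ : (a *: f : bop) x = a *: f x)//.
by rewrite normrZ -mulrA ler_wpM2l// le_opnorm.
Qed.

Lemma opnormZ a (f : bop) : opnorm (a *: f) = `|a| * opnorm f.
Proof.
apply/eqP; rewrite eq_le opnormZ_le /=.
have [->|a0] := eqVneq a 0; first by rewrite normr0 mul0r opnorm_ge0.
rewrite -ler_pdivlMl ?normr_gt0// -normfV.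
by rewrite -[in leLHS](scalerK a0 f) opnormZ_le.
Qed.

Lemma opnorm0_eq0 (f : bop) : opnorm f = 0 -> f = 0.
Proof.
move=> f0; apply: val_inj; apply/funext => x /=; apply/eqP.
by rewrite -normr_le0 (le_trans (le_opnorm f x))// f0 mul0r.
Qed.

HB.instance Definition _ :=
  Lmodule_isNormed.Build R bop opnormD opnormZ opnorm0_eq0.

End BoundedOperators.

Notation "''L' ( X , Y )" := (bop (fun x : X => `|x|) Y)
  (at level 8, format "''L' ( X ,  Y )") : type_scope.

Section Derivatives.
Context (R : realType) (X Y : normedModType R).
Implicit Types (U : set X) (f : X -> Y).

(* The library differential 'd f q as an element of L(X, Y). *)
Definition Der f (q : X) : 'L(X, Y) :=
  xget 0 [set A : 'L(X, Y) | A = 'd f q :> (X -> Y)].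

Lemma DerE f q : differentiable f q -> Der f q = 'd f q :> (X -> Y).
Proof.
move=> dfq; rewrite /Der; case: xgetP => // /(_ _) none; exfalso.
have fq : (('d f q : X -> Y) \in @bop_pred R X (fun x => `|x|) Y).
  apply/asboolP; split; first exact: linearP.
  have dfc : continuous ('d f q) by exact: diff_continuous.
  have := continuous_linear_bounded 0 (dfc 0).
  move=> /linear_boundedP/pinfty_ex_gt0[r r0 fr].
  by exists r; split; first exact: ltW.
exact: (none (Bop fq)).
Qed.

Definition C0_on (T : topologicalType) (S : set T) (Z : topologicalType)
  (f : T -> Z) : Prop := forall q, S q -> {for q, continuous f}.

Definition C1_on U f : Prop :=
  (forall q, U q -> differentiable f q) /\ C0_on U (Der f).

End Derivatives.

Definition C2_on (R : realType) (X Y : normedModType R) (U : set X)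
    (f : X -> Y) : Prop :=
  (forall q, U q -> differentiable f q) /\ C1_on U (Der f).

Section Interpolation.
Context (R : realType) (K0 K1 : hilbertType R) (i : {linear K1 -> K0}).

(* The positive self-adjoint operator on K0 with domain (the image under the
   inclusion i of) K1 such that |L x|_0 = |x|_1. The third clause says that the
   domain of the adjoint is contained in K1. *)
Definition is_Lambda (L : {linear K1 -> K0}) : Prop :=
  [/\ forall x y, dotp (L x) (i y) = dotp (i x) (L y),
      forall x, 0 <= dotp (L x) (i x),
      forall y z : K0, (forall x, dotp (L x) y = dotp (i x) z) ->
        exists y1 : K1, y = i y1
    & forall x, `|L x| = `|x| ].

Definition Lambda : {linear K1 -> K0} := get is_Lambda.

(* The graph of Lambda^s. For i dense and compact, Lambda has compact inverse,
   so its eigenvectors span a dense subspace, and Lambda^s is the operator of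
   maximal domain acting as l^s along each eigenvector of eigenvalue l. *)
Definition Lambda_pow (s : R) (x y : K0) : Prop :=
  forall (e : K1) (l : R), Lambda e = l *: i e ->
    dotp y (i e) = l `^ s * dotp x (i e).

Definition pow_dom (s : R) : {pred K0} :=
  fun x => `[< exists y, Lambda_pow s x y >].

Lemma pow_dom_submod_closed s : submod_closed (pow_dom s).
Proof.
have dotp0 (z : K0) : dotp 0 z = 0.
  by have := dotp_linear 1 0 0 z; rewrite scaler0 addr0 mul1r => /eqP;
    rewrite -subr_eq0 opprD addNKr oppr_eq0 => /eqP.
split=> [|a x x' /asboolP[y xy] /asboolP[y' xy']].
  by apply/asboolP; exists 0 => e l _; rewrite dotp0 mulr0.
apply/asboolP; exists (a *: y + y') => e l el.
rewrite !dotp_linear (xy e l)// (xy' e l)// mulrDr; congr (_ + _).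
exact: mulrCA.
Qed.

HB.instance Definition _ s :=
  GRing.isSubmodClosed.Build R K0 (pow_dom s) (pow_dom_submod_closed s).

(* interp s is dom(Lambda^s), with gauge interp_norm x = |Lambda^s x|_0. *)
Record interp (s : R) := Interp {
  interp_val :> K0;
  _ : interp_val \in pow_dom s
}.

HB.instance Definition _ s := [isSub for @interp_val s].
HB.instance Definition _ s := [Choice of interp s by <:].
HB.instance Definition _ s := [SubChoice_isSubLmodule of interp s by <:].

Definition interp_norm (s : R) (x : interp s) : R :=
  `| xget 0 [set y | Lambda_pow s x y] |.

End Interpolation.

(* 'L(interp s i, Y; Z) is L(H_s, Y; Z), H_s interpolating the inclusion i.
   Bounded bilinear maps X x Y -> Z are taken in curried form, as elements of
   L(X, L(Y, Z)) with the same norm. *)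
Notation "''L' ( 'interp' s i , Y ; Z )" :=
  (bop (@interp_norm _ _ _ i s) 'L(Y, Z))
  (at level 8, s at level 0, i at level 0,
   format "''L' ( 'interp'  s  i ,  Y ;  Z )") : type_scope.

Definition compact_op (R : realType) (X Y : normedModType R) (f : X -> Y) :=
  precompact (f @` [set x | `|x| <= 1]).

Definition hilbert_triple (R : realType) (H0 H1 H2 : hilbertType R)
    (i1 : {linear H1 -> H0}) (i2 : {linear H2 -> H1}) : Prop :=
  [/\ injective i1 /\ injective i2,
      dense (range i1) /\ dense (range i2)
    & compact_op i1 /\ compact_op i2].

(* Hm1, with j : H0 -> Hm1, is a completion of H0 in the norm |.|_{-1}. *)
Definition negative_completion (R : realType) (H0 H1 : hilbertType R)
    (i1 : {linear H1 -> H0}) (Hm1 : completeNormedModType R)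
    (j : {linear H0 -> Hm1}) : Prop :=
  dense (range j) /\
  forall eta : H0, `|j eta| =
    sup [set `|dotp eta (i1 xi)| / `|xi| | xi in [set xi : H1 | xi != 0]].

Section Floer.
Context (R : realType) (H0 H1 H2 : hilbertType R)
  (i1 : {linear H1 -> H0}) (i2 : {linear H2 -> H1})
  (Hm1 : completeNormedModType R) (j : {linear H0 -> Hm1}).

(* Maps U -> V are total functions constrained on U only; U_2 is i2 @^-1` U. *)
Definition two_level_ssc2 (U V : set H1) (phi : H1 -> H1) : Prop :=
  [/\ forall q, U q -> V (phi q),
      C2_on U phi
    & exists phi2 : H2 -> H2,
        (forall q, U (i2 q) -> i2 (phi2 q) = phi (i2 q)) /\
        C2_on (i2 @^-1` U) phi2].

(* Since H_1 and H_s are separate types, "D2 extends d^2 phi" (and below, "D2m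
   extends the restriction of D2") is expressed by comparing vectors with the
   same image in H0. *)
Definition floer1 (s : R) (U : set H1) (phi : H1 -> H1) (D : H1 -> 'L(H0, H0))
    (D2 : H1 -> 'L(interp s i1, H0; H0)) : Prop :=
  [/\ forall q, U q -> forall xi : H1, D q (i1 xi) = i1 (Der phi q xi),
      C1_on U D,
      forall q, U q -> forall (xi eta : H1) (x : interp i1 s),
        interp_val x = i1 xi ->
        D2 q x (i1 eta) = i1 (Der (Der phi) q xi eta)
    & C0_on U D2].

Definition floer2 (s : R) (U : set H1) (D : H1 -> 'L(H0, H0))
    (D2 : H1 -> 'L(interp s i1, H0; H0)) (Dm : H2 -> 'L(Hm1, Hm1))
    (D2m : H2 -> 'L(interp s i2, Hm1; Hm1)) : Prop :=
  let U2 := i2 @^-1` U in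
  [/\ forall q, U2 q -> forall eta : H0, Dm q (j eta) = j (D (i2 q) eta),
      C1_on U2 Dm,
      forall q, U2 q -> forall (x : interp i2 s) (x' : interp i1 s) (eta : H0),
        interp_val x' = i1 (interp_val x) ->
        D2m q x (j eta) = j (D2 (i2 q) x' eta)
    & C0_on U2 D2m].

Definition s_floer (s : R) (U V : set H1) (phi : H1 -> H1) : Prop :=
  two_level_ssc2 U V phi /\
  exists D D2 Dm D2m, floer1 (s := s) U phi D D2 /\ floer2 U D D2 Dm D2m.

End Floer.

(* Main.v *)
(* By the chain rule, the derivatives of the composition are
     D(psi o phi)_q = Dpsi_{phi q} Dphi_q,
     D^2(psi o phi)_q (x, y) =
       D^2psi_{phi q} (Dphi_q x, Dphi_q y) + Dpsi_{phi q} (D^2phi_q (x, y)).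
   The only point beyond product rules is that in the first summand Dphi_q must
   act on H_s, continuously in q (and dphi_q on H_{1+s}). This is interpolation:
   an operator bounded by M on both ends K0 and K1 of a compact inclusion i is
   bounded by C M on dom(Lambda^s). Let e_n be the right singular vectors of i,
   and f_n = l_n i e_n the left ones. Then Lambda e_n = l_n i e_n, so that
   |Lambda^s x|^2 is the sum of l_n^(2s) <x, f_n>^2. The K-functional of x at t
   is, up to constants, the sum of l_n^2 / (l_n^2 + t) <x, f_n>^2; the operator
   increases it at most by the factor M^2, and summing over dyadic t with weight
   t^s recovers the interpolation norm. *)
From HB Require Import structures.
Require Import Defs.
From mathcomp Require Import all_boot all_order all_algebra.
From mathcomp Require Import all_classical all_reals all_analysis.
From mathcomp Require Import ring lra.
Import Order.TTheory GRing.Theory Num.Theory.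
Import numFieldNormedType.Exports.
Set Implicit Arguments.
Unset Strict Implicit.
Unset Printing Implicit Defensive.
Local Open Scope classical_set_scope.
Local Open Scope ring_scope.

(** * Hilbert spaces *)

Lemma cvg_le_bound (R : realType) (u : nat -> R) l B :
  u @ \oo --> l -> (forall n, u n <= B) -> l <= B.
Proof.
move=> ul uB; apply: (ler_cvg_to ul (g := fun=> B)); first exact: cvg_cst.
exact: nearW.
Qed.

Lemma cvg_seq_unique (R : realType) (V : normedModType R) (u v : nat -> V) (a b : V) :
  u @ \oo --> a -> v @ \oo --> b -> (forall n, u n = v n) -> a = b.
Proof.
move=> ua vb /funext uv; move: ua; rewrite uv => va.
exact: (cvg_unique (@norm_hausdorff _ _) va vb).
Qed.

Lemma cvg_seq_cst (R : realType) (V : normedModType R) (u : nat -> V) (a b : V) :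
  u @ \oo --> a -> (forall n, u n = b) -> a = b.
Proof. by move=> ua ub; apply: (cvg_seq_unique ua _ ub); exact: cvg_cst. Qed.

Section InnerProduct.
Context (R : realType) (H : hilbertType R).
Implicit Types (x y z : H) (a : R).

Lemma dotpDl x y z : dotp (x + y) z = dotp x z + dotp y z.
Proof. by have := dotp_linear 1 x y z; rewrite scale1r mul1r. Qed.

Lemma dotp0l z : dotp 0 z = 0.
Proof. by apply: (addIr (dotp 0 z)); rewrite -dotpDl !add0r. Qed.

Lemma dotpZl a x z : dotp (a *: x) z = a * dotp x z.
Proof. by have := dotp_linear a x 0 z; rewrite !addr0 dotp0l addr0. Qed.

Lemma dotpDr x y z : dotp z (x + y) = dotp z x + dotp z y.
Proof. by rewrite ![dotp z _]dotpC dotpDl. Qed.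

Lemma dotpZr a x z : dotp z (a *: x) = a * dotp z x.
Proof. by rewrite ![dotp z _]dotpC dotpZl. Qed.

Lemma dotp0r z : dotp z 0 = 0.
Proof. by rewrite dotpC dotp0l. Qed.

Lemma dotpNl x z : dotp (- x) z = - dotp x z.
Proof. by rewrite -scaleN1r dotpZl mulN1r. Qed.

Lemma dotpNr x z : dotp z (- x) = - dotp z x.
Proof. by rewrite dotpC dotpNl dotpC. Qed.

Lemma dotpBl x y z : dotp (x - y) z = dotp x z - dotp y z.
Proof. by rewrite dotpDl dotpNl. Qed.

Lemma dotpBr x y z : dotp z (x - y) = dotp z x - dotp z y.
Proof. by rewrite dotpDr dotpNr. Qed.

Lemma dotp_suml (I : Type) (r : seq I) (P : pred I) (F : I -> H) z :
  dotp (\sum_(k <- r | P k) F k) z = \sum_(k <- r | P k) dotp (F k) z.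
Proof.
by elim/big_rec2: _ => [|k u v _ <-]; [exact: dotp0l|exact: dotpDl].
Qed.

Lemma dotp_sumr (I : Type) (r : seq I) (P : pred I) (F : I -> H) z :
  dotp z (\sum_(k <- r | P k) F k) = \sum_(k <- r | P k) dotp z (F k).
Proof. by rewrite dotpC dotp_suml; apply: eq_bigr => k _; exact: dotpC. Qed.

Lemma dotp_eq0 x : dotp x x = 0 -> x = 0.
Proof. by rewrite dotp_norm => /eqP; rewrite sqrf_eq0 normr_eq0 => /eqP. Qed.

Lemma normD2 x y : `|x + y| ^+ 2 = `|x| ^+ 2 + 2 * dotp x y + `|y| ^+ 2.
Proof. by rewrite -!dotp_norm dotpDl !dotpDr (dotpC y x); ring. Qed.

Lemma normB2 x y : `|x - y| ^+ 2 = `|x| ^+ 2 - 2 * dotp x y + `|y| ^+ 2.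
Proof. by rewrite normD2 dotpNr normrN mulrN. Qed.

Lemma parallelogram x y :
  `|x + y| ^+ 2 + `|x - y| ^+ 2 = 2 * (`|x| ^+ 2 + `|y| ^+ 2).
Proof. by rewrite normD2 normB2; ring. Qed.

Lemma cauchy_schwarz x y : `|dotp x y| <= `|x| * `|y|.
Proof.
have [->|y0] := eqVneq y 0; first by rewrite dotp0r !normr0 mulr0.
have ny0 : 0 < `|y| by rewrite normr_gt0.
rewrite -(@ler_pXn2r _ 2) ?nnegrE ?mulr_ge0// exprMn real_normK ?num_real//.
have /(mulr_ge0 (ltW (exprn_gt0 2 ny0))) :=
  sqr_ge0 `|x - (dotp x y / `|y| ^+ 2) *: y|.
rewrite normB2 dotpZr normrZ exprMn real_normK ?num_real//.
set d := dotp x y; set nx := `|x|; set ny := `|y| in ny0 *.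
suff -> : ny ^+ 2 * (nx ^+ 2 - 2 * (d / ny ^+ 2 * d) + (d / ny ^+ 2) ^+ 2 * ny ^+ 2)
  = nx ^+ 2 * ny ^+ 2 - d ^+ 2 by rewrite subr_ge0.
by field; rewrite lt0r_neq0.
Qed.

Lemma cvg_dotpl (u : nat -> H) l z :
  u @ \oo --> l -> (fun n => dotp (u n) z) @ \oo --> dotp l z.
Proof.
move=> ul; apply/cvgrPdist_le => e e0.
have d0 : 0 < e / (`|z| + 1) by rewrite divr_gt0// ltr_wpDl.
move/cvgrPdist_le/(_ _ d0) : ul; apply: filterS => n uln.
rewrite -dotpBl (le_trans (cauchy_schwarz _ _))//.
rewrite (le_trans (ler_wpM2r (normr_ge0 z) uln))//.
rewrite mulrAC ler_pdivrMr ?ltr_wpDl// ler_pM2l// lerDl.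
by rewrite ler01.
Qed.

Lemma cvg_dotpr (u : nat -> H) l z :
  u @ \oo --> l -> (fun n => dotp z (u n)) @ \oo --> dotp z l.
Proof.
by move=> /(@cvg_dotpl _ _ z); under eq_fun do rewrite dotpC; rewrite dotpC.
Qed.

End InnerProduct.

(* Allowing f n = 0 lets finite and infinite families be treated alike. *)
Definition orthonormal0 (R : realType) (H : hilbertType R) (f : nat -> H) :=
  (forall m n, m != n -> dotp (f m) (f n) = 0) /\
  (forall n, f n = 0 \/ `|f n| = 1).

Section Orthonormal.
Context (R : realType) (H : hilbertType R) (f : nat -> H).
Hypothesis fo : orthonormal0 f.
Implicit Types (x y : H) (c : nat -> R).

(** The condition on [c] is forced by the zero vectors allowed in [f]: pairing with [f n = 0] can
    only return the coefficient 0. *)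
Lemma dotp_fourier_sum N c n : (forall k, f k = 0 -> c k = 0) ->
  dotp (\sum_(k < N) c k *: f k) (f n) = if (n < N)%N then c n else 0.
Proof.
move=> c0; have [of' nf] := fo; rewrite dotp_suml; case: ifPn => nN.
  rewrite (bigD1 (Ordinal nN))//= big1 ?addr0.
    rewrite dotpZl dotp_norm; case: (nf n) => [fn|->]; last by rewrite expr1n mulr1.
    by rewrite c0// mul0r.
  move=> k kn; rewrite dotpZl of' ?mulr0//.
rewrite big1// => k _; rewrite dotpZl of' ?mulr0//.
by apply: contraNneq nN => <-.
Qed.

(** Pythagoras, weakened to an inequality because the coefficients along zero vectors are lost. *)
Lemma norm2_fourier_sum N M c :
  `|\sum_(N <= k < M) c k *: f k| ^+ 2 <= \sum_(N <= k < M) c k ^+ 2.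
Proof.
have [of' nf] := fo; rewrite -dotp_norm dotp_suml ler_sum_nat// => k /andP[Nk kM].
rewrite dotp_sumr (big_rem k) ?mem_index_iota ?Nk//= big_seq_cond big1.
  rewrite addr0 dotpZl dotpZr dotp_norm.
  by case: (nf k) => [->|->]; rewrite ?normr0 ?expr1n ?expr0n/= ?mulr0 ?sqr_ge0// mulr1.
move=> l /andP[lr _]; rewrite dotpZl dotpZr of' ?mulr0//.
apply: contraTneq lr => <-.
by rewrite mem_rem_uniqF// iota_uniq.
Qed.

Lemma norm2_fourier_sum_ord N c :
  `|\sum_(k < N) c k *: f k| ^+ 2 <= \sum_(k < N) c k ^+ 2.
Proof. by have := norm2_fourier_sum 0 N c; rewrite !big_mkord. Qed.

Lemma dotp_sub_fourier_sum N x n : (n < N)%N ->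
  dotp (x - \sum_(k < N) dotp x (f k) *: f k) (f n) = 0.
Proof.
move=> nN; rewrite dotpBl (@dotp_fourier_sum N (fun k => dotp x (f k))).
  by rewrite nN subrr.
move=> k ->.
by rewrite dotp0r.
Qed.

Lemma bessel N x : \sum_(k < N) dotp x (f k) ^+ 2 <= `|x| ^+ 2.
Proof.
set S := \sum_(k < N) dotp x (f k) *: f k.
have xS : dotp x S = \sum_(k < N) dotp x (f k) ^+ 2.
  by rewrite dotp_sumr; apply: eq_bigr => k _; rewrite dotpZr expr2.
have := norm2_fourier_sum_ord N (fun k => dotp x (f k)).
have := sqr_ge0 `|x - S|; rewrite normB2 xS -/S => h1 h2.
lra.
Qed.

Lemma norm_sub_fourier_sum N x :
  `|x - \sum_(k < N) dotp x (f k) *: f k| <= `|x|.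
Proof.
set S := \sum_(k < N) _.
have xS : dotp x S = \sum_(k < N) dotp x (f k) ^+ 2.
  by rewrite dotp_sumr; apply: eq_bigr => k _; rewrite dotpZr expr2.
have := norm2_fourier_sum_ord N (fun k => dotp x (f k)).
have : 0 <= \sum_(k < N) dotp x (f k) ^+ 2 by apply: sumr_ge0 => k _; exact: sqr_ge0.
move=> h0 h1; rewrite -(@ler_pXn2r _ 2) ?nnegrE// (normB2 x S) xS.
lra.
Qed.

(** Riesz-Fischer: tails of the vector series are dominated by tails of the convergent series of
    squares, so its partial sums are Cauchy. *)
Lemma fourier_sum_cvg c (B : R) : (forall N, \sum_(k < N) c k ^+ 2 <= B) ->
  exists2 y, (fun N => \sum_(k < N) c k *: f k) @ \oo --> y & `|y| ^+ 2 <= B.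
Proof.
move=> cB.
have cvgc : cvgn (series (fun k => c k ^+ 2)).
  apply: nondecreasing_is_cvgn.
    by apply: nondecreasing_series => k _ _; exact: sqr_ge0.
  by exists B => _ [N _ <-]; rewrite seriesEord; exact: cB.
have : cvgn (series (fun k => c k *: f k)).
  apply/cauchy_cvgP/cauchy_seriesP => e e0.
  have e20 : 0 < e ^+ 2 by rewrite exprn_gt0.
  move/cauchy_cvgP/cauchy_seriesP/(_ _ e20) : cvgc.
  apply: filterS => -[N M]/= NM.
  rewrite -(@ltr_pXn2r _ 2) ?nnegrE ?(ltW e0)//.
  apply: le_lt_trans NM; rewrite (le_trans (norm2_fourier_sum _ _ _))//.
  exact: ler_norm.
move=> /cvg_ex[y]; rewrite seriesEord => cy.
exists y => //.
have cn : (fun N => `|\sum_(k < N) c k *: f k| ^+ 2) @ \oo --> `|y| ^+ 2.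
  exact: cvgM (cvg_norm cy) (cvg_norm cy).
apply: (cvg_le_bound cn) => N.
exact: le_trans (norm2_fourier_sum_ord _ _) _.
Qed.

Lemma fourier_series_cvg x :
  exists y, (fun N => \sum_(k < N) dotp x (f k) *: f k) @ \oo --> y.
Proof.
have [y xy _] := @fourier_sum_cvg (fun k => dotp x (f k)) _ (fun N => bessel N x).
by exists y.
Qed.

End Orthonormal.

(** * Singular value decomposition of compact operators *)

Section CompactOperators.
Context (R : realType) (K0 K1 : hilbertType R) (i : {linear K1 -> K0}).

Lemma compact_op_bounded : compact_op i ->
  exists2 C, 0 < C & forall x, `|i x| <= C * `|x|.
Proof.
rewrite /compact_op precompactE => /compact_bounded/pinfty_ex_gt0[C C0 iC].
exists C => // x; have [->|x0] := eqVneq x 0.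
  by rewrite linear0 !normr0 mulr0.
have nx0 : 0 < `|x| by rewrite normr_gt0.
have /iC : closure (i @` [set x | `|x| <= 1]) (i (`|x|^-1 *: x)).
  apply: subset_closure; exists (`|x|^-1 *: x) => //=.
  by rewrite normrZ normfV normr_id mulVf// lt0r_neq0.
by rewrite linearZ/= normrZ normfV normr_id mulrC ler_pdivrMr.
Qed.

(** [g] need not be increasing. A cluster point [z] of [i (u n)] and the bound [k <= g k] suffice to
    pick close images with arbitrarily large indices. *)
Lemma compact_op_subseq (u : nat -> K1) : compact_op i ->
  (forall n, `|u n| <= 1) ->
  exists z (g : nat -> nat), forall k,
    (k <= g k)%N /\ `|i (u (g k)) - z| < k.+1%:R^-1.
Proof.
rewrite /compact_op precompactE => ci u1.
have PF : ProperFilter ((i \o u) @ \oo) by exact: fmap_proper_filter.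
have [|z [_ cz]] := ci _ PF.
  by exists 0%N => // n _; apply: subset_closure; exists (u n) => //=.
exists z.
suff /choice[g gP] : forall k, exists n,
    (k <= n)%N /\ `|i (u n) - z| < k.+1%:R^-1 by exists g.
move=> k.
have A1 : ((i \o u) @ \oo) [set i (u n) | n in [set n | (k <= n)%N]].
  by exists k => // n kn; exists n.
have A2 : nbhs z (ball z k.+1%:R^-1) by apply: nbhsx_ballx; rewrite invr_gt0.
have [_ [[n kn <-]]] := cz _ _ A1 A2.
by rewrite -ball_normE/= distrC => zn; exists n.
Qed.

Lemma cvg_linear (u : nat -> K1) l : compact_op i ->
  u @ \oo --> l -> (fun n => i (u n)) @ \oo --> i l.
Proof.
move=> /compact_op_bounded[C C0 iC] ul; apply/cvgrPdist_le => e e0.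
have d0 : 0 < e / C by rewrite divr_gt0.
move/cvgrPdist_le/(_ _ d0) : ul; apply: filterS => n uln.
by rewrite -linearB (le_trans (iC _))// mulrC -ler_pdivlMr.
Qed.

(* A maximising sequence w for |i w| on the unit ball of M, chosen so that i w
   converges, is Cauchy: |w_k + w_l| tends to 2, so the parallelogram law
   forces |w_k - w_l| to 0. *)
Lemma compact_op_maximizer (M : set K1) : compact_op i -> M 0 ->
  (forall a x, M x -> M (a *: x)) -> (forall x y, M x -> M y -> M (x + y)) ->
  (forall u l, (forall n : nat, M (u n)) -> u @ \oo --> l -> M l) ->
  exists e, [/\ M e, e = 0 \/ `|e| = 1 & forall y, M y -> `|i y| <= `|i e| * `|y|].
Proof.
move=> ci M0 MZ MD Mcl.
have [C C0 iC] := compact_op_bounded ci.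
pose S := [set `|i x| | x in [set x | M x /\ `|x| <= 1]].
have supS : has_sup S.
  split; first by exists `|i 0|, 0 => //=; split=> //; rewrite normr0.
  exists C => _ [x [_ x1] <-].
  by rewrite (le_trans (iC x))// ler_piMr// ltW.
set mu := sup S.
have muP y : M y -> `|i y| <= mu * `|y|.
  move=> My; have [->|y0] := eqVneq y 0; first by rewrite linear0 !normr0 mulr0.
  have ny0 : 0 < `|y| by rewrite normr_gt0.
  rewrite -ler_pdivrMr//; apply: (ub_le_sup (proj2 supS)).
  exists (`|y|^-1 *: y); last by rewrite linearZ/= normrZ normfV normr_id mulrC.
  split; first exact: MZ.
  by rewrite normrZ normfV normr_id mulVf// lt0r_neq0.
(* If [mu <= 0], then [i] vanishes on [M] and the zero vector is a maximiser. *)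
have [mu0|mu0] := leP mu 0.
  exists 0; split=> // [|y My]; first by left.
  by rewrite linear0 normr0 mul0r (le_trans (muP _ My))// mulr_le0_ge0.
have /choice[x xP] : forall n : nat, exists x,
    [/\ M x, `|x| <= 1 & mu - n.+1%:R^-1 < `|i x|].
  move=> n; have n0 : 0 < n.+1%:R^-1 :> R by rewrite invr_gt0.
  by have [_ [x [Mx x1] <-] h] := sup_adherent n0 supS; exists x.
have [z [g gP]] : exists z (g : nat -> nat), forall k,
    (k <= g k)%N /\ `|i (x (g k)) - z| < k.+1%:R^-1.
  by apply: compact_op_subseq => // n; case: (xP n).
pose w k := x (g k).
have invS m n : (m <= n)%N -> (n.+1%:R^-1 : R) <= m.+1%:R^-1.
  by move=> mn; rewrite lef_pV2 ?posrE// ler_nat.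
have Mw k : M (w k) by case: (xP (g k)).
have w1 k : `|w k| <= 1 by case: (xP (g k)).
have iw k : mu - k.+1%:R^-1 <= `|i (w k)|.
  have [_ _ /ltW] := xP (g k); apply: le_trans.
  by rewrite lerD2l lerN2 invS//; case: (gP k).
have iwz k : `|i (w k) - z| <= k.+1%:R^-1 by case: (gP k) => _ /ltW.
(* With [a = |w k + w l|], maximality gives [mu * a >= 2 * mu - 5 * d]. Since [a^2 >= 4 * a - 4],
   the parallelogram law leaves at most [20 * d / mu] for [|w k - w l|^2]. *)
have wcauchy N k l : (N <= k)%N -> (N <= l)%N ->
    `|w k - w l| ^+ 2 <= 20 / mu * N.+1%:R^-1.
  move=> Nk Nl; set d := N.+1%:R^-1.
  have d0 : 0 < d :> R by rewrite invr_gt0.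
  have kd : k.+1%:R^-1 <= d by exact: invS.
  have ld : l.+1%:R^-1 <= d by exact: invS.
  have h1 : 2 * mu - 5 * d <= mu * `|w k + w l|.
    apply: le_trans (muP _ (MD _ _ (Mw k) (Mw l))); rewrite linearD.
    have -> : i (w k) + i (w l) =
        i (w k) *+ 2 - ((i (w k) - z) - (i (w l) - z)).
      by rewrite !opprB subrKA addrCA mulr2n addrK addrC.
    rewrite (le_trans _ (lerB_dist _ _))// normrMn [`|i _| *+ 2]mulr2n.
    have := ler_normB (i (w k) - z) (i (w l) - z).
    move: (iw k) (iwz k) (iwz l) kd ld d0.
    move: (k.+1%:R^-1) (l.+1%:R^-1) d => p q d.
    lra.
  have wkl : `|w k + w l| ^+ 2 + `|w k - w l| ^+ 2 <= 4.
    rewrite parallelogram; have := w1 k; have := w1 l.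
    have := normr_ge0 (w k); have := normr_ge0 (w l); nra.
  rewrite mulrAC ler_pdivlMr//.
  set a := `|w k + w l| in h1 wkl; set b := `|w k - w l| ^+ 2 in wkl *.
  have a0 : 0 <= a by exact: normr_ge0.
  have a2 : 0 <= (a - 2) ^+ 2 by exact: sqr_ge0.
  nra.
have : cvgn w.
  apply/cauchy_cvgP/cauchy_ballP => eps eps0.
  have c0 : 0 < eps ^+ 2 * (mu / 20) by rewrite !mulr_gt0// exprn_gt0.
  have [N Neps] := ltr_add_invr c0; rewrite add0r in Neps.
  near_simpl; exists ([set n | (N <= n)%N], [set n | (N <= n)%N]).
    by split; exists N.
  case=> k l [/= Nk Nl]; rewrite -ball_normE/= -(@ltr_pXn2r _ 2) ?nnegrE ?(ltW eps0)//.
  apply: le_lt_trans (wcauchy _ _ _ Nk Nl) _.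
  by rewrite mulrC -ltr_pdivlMr ?divr_gt0// invf_div.
move=> /cvg_ex[l wl].
have Ml : M l by exact: Mcl Mw wl.
have l1 : `|l| <= 1.
  by apply: (@cvg_le_bound _ (fun n => `|w n|)) => //; exact: cvg_norm.
have mul : mu <= `|i l|.
  have h : (fun n => - `|i (w n)|) @ \oo --> - `|i l|.
    by apply: cvgN; apply: cvg_norm; exact: cvg_linear.
  apply/ler_addgt0Pr => eps eps0; rewrite -lerBlDr.
  rewrite -lerN2; apply: (ler_cvg_to h (g := fun=> - (mu - eps))).
    exact: cvg_cst.
  have [N Neps] := ltr_add_invr eps0; rewrite add0r in Neps.
  exists N => // n /= Nn; rewrite lerN2; apply: le_trans (iw n).
  by rewrite lerD2l lerN2 (le_trans (invS _ _ Nn))// ltW.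
have l1' : 1 <= `|l|.
  by rewrite -(ler_pM2l mu0) mulr1 (le_trans mul)// muP.
exists l; split=> //; first by right; apply/eqP; rewrite eq_le l1.
by move=> y My; rewrite (le_trans (muP _ My))// ler_wpM2r.
Unshelve. all: by end_near. Qed.

(** First variation: comparing [|i (e + t y)|^2] with [mu^2 |e + t y|^2] for every real [t] gives
    [2 t d <= t^2 c], where [d] is the defect in the claimed identity. This forces [d = 0]. *)
Lemma maximizer_stationary (M : set K1) e : M e -> e = 0 \/ `|e| = 1 ->
  (forall a x, M x -> M (a *: x)) -> (forall x y, M x -> M y -> M (x + y)) ->
  (forall y, M y -> `|i y| <= `|i e| * `|y|) ->
  forall y, M y -> dotp (i e) (i y) = `|i e| ^+ 2 * dotp e y.
Proof.
move=> Me [->|e1] MZ MD emax y My.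
  by rewrite linear0 !dotp0l mulr0.
set mu := `|i e|; set c := mu ^+ 2 * `|y| ^+ 2 - `|i y| ^+ 2.
have mu0 : 0 <= mu by exact: normr_ge0.
have c0 : 0 <= c.
  rewrite subr_ge0 -exprMn ler_pXn2r ?nnegrE ?mulr_ge0//; exact: emax.
set d := dotp (i e) (i y) - mu ^+ 2 * dotp e y.
suff /eqP : d = 0 by rewrite subr_eq0 => /eqP.
have key t : 2 * t * d <= t ^+ 2 * c.
  have : `|i (e + t *: y)| ^+ 2 <= mu ^+ 2 * `|e + t *: y| ^+ 2.
    rewrite -exprMn ler_pXn2r ?nnegrE ?mulr_ge0//.
    by apply: emax; apply: MD => //; exact: MZ.
  rewrite linearD linearZ/= !normD2 !dotpZr !normrZ !exprMn real_normK ?num_real//.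
  rewrite e1 -/mu /d /c; nra.
have c1 : 0 < c + 1 by rewrite ltr_wpDl.
(* This value of [t] turns the inequality into [2 d^2 (c + 1) <= d^2 c]; the denominator [c + 1] is
   positive even when [c = 0]. *)
have := key (d / (c + 1)).
have -> : 2 * (d / (c + 1)) * d = (2 * d ^+ 2 * (c + 1)) / (c + 1) ^+ 2.
  by field; rewrite lt0r_neq0.
have -> : (d / (c + 1)) ^+ 2 * c = (d ^+ 2 * c) / (c + 1) ^+ 2.
  by field; rewrite lt0r_neq0.
rewrite ler_pM2r ?invr_gt0 ?exprn_gt0// => h.
have d2 : 0 <= d ^+ 2 by exact: sqr_ge0.
by apply/eqP; rewrite -sqrf_eq0 eq_le d2 andbT; nra.
Qed.

End CompactOperators.

(** The second clause is the weak form of the eigenvalue equation of the adjoint of [i] composed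
    with [i], stated without constructing the adjoint. *)
Definition singular_system (R : realType) (K0 K1 : hilbertType R)
    (i : {linear K1 -> K0}) (e : nat -> K1) : Prop :=
  [/\ orthonormal0 e,
      forall n y, dotp (i (e n)) (i y) = `|i (e n)| ^+ 2 * dotp (e n) y
    & forall x, (fun N => \sum_(k < N) dotp x (e k) *: i (e k)) @ \oo --> i x].

(** * Greedy construction of a singular system *)

Section SingularSystem.
Context (R : realType) (K0 K1 : hilbertType R) (i : {linear K1 -> K0}).
Hypothesis ci : compact_op i.

Let perp (S : set K1) := [set x | forall y, S y -> dotp x y = 0].

Let perpZ S a x : perp S x -> perp S (a *: x).
Proof. by move=> Sx y Sy; rewrite dotpZl Sx// mulr0. Qed.

Let perpD S x y : perp S x -> perp S y -> perp S (x + y).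
Proof. by move=> Sx Sy z Sz; rewrite dotpDl Sx// Sy// addr0. Qed.

Let perp_maximizer S : {e | [/\ perp S e, e = 0 \/ `|e| = 1 &
  forall y, perp S y -> `|i y| <= `|i e| * `|y|]}.
Proof.
apply: cid; apply: compact_op_maximizer => //.
- by move=> y _; rewrite dotp0l.
- exact: perpZ.
- exact: perpD.
- move=> u l Su ul y Sy; have := @cvg_dotpl _ _ _ _ y ul.
  under eq_fun do rewrite (Su _ _ Sy).
  by move=> /(cvg_lim (@Rhausdorff R)) <-; rewrite lim_cst.
Qed.

(** The set of vectors chosen before stage [n]. Recursing on this set lets each new vector be a
    maximiser of [|i x|] on the orthogonal complement of all earlier ones. *)
Let hist := fix h n : set K1 :=
  if n is m.+1 then h m `|` [set sval (perp_maximizer (h m))] else set0.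

Let e n := sval (perp_maximizer (hist n)).

Let hist_mem k n : (k < n)%N -> hist n (e k).
Proof.
elim: n => // n IH; rewrite ltnS leq_eqVlt => /orP[/eqP->|/IH]; first by right.
by left.
Qed.

Let histE n x : hist n x -> exists2 k, (k < n)%N & x = e k.
Proof.
elim: n => // n IH [/IH[k kn ->]|->]; last by exists n.
by exists k => //; rewrite ltnS ltnW.
Qed.

Let perp_hist n x : (forall k, (k < n)%N -> dotp x (e k) = 0) -> perp (hist n) x.
Proof. by move=> xe y /histE[k kn ->]; exact: xe. Qed.

Let eP n : [/\ perp (hist n) (e n), e n = 0 \/ `|e n| = 1 &
  forall y, perp (hist n) y -> `|i y| <= `|i (e n)| * `|y|].
Proof. exact: (svalP (perp_maximizer (hist n))). Qed.

Let e_perp k n : (k < n)%N -> dotp (e n) (e k) = 0.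
Proof. by move=> kn; case: (eP n) => + _ _; apply; exact: hist_mem. Qed.

Let eo : orthonormal0 e.
Proof.
split=> [m n|n]; last by case: (eP n).
by rewrite neq_lt => /orP[mn|nm]; [rewrite dotpC|]; rewrite e_perp.
Qed.

Let stationary_perp n y : perp (hist n) y ->
  dotp (i (e n)) (i y) = `|i (e n)| ^+ 2 * dotp (e n) y.
Proof.
have [pe e01 emax] := eP n.
apply: (@maximizer_stationary _ _ _ i (perp (hist n))) => //.
- exact: perpZ.
- exact: perpD.
Qed.

(** Stationarity is known on the complement of the earlier vectors. The remaining component [S] of
    [y] contributes nothing: [e n] is orthogonal to each earlier [e k], and stationarity at [k]
    makes [i (e n)] orthogonal to [i (e k)]. *)
Let stationary n y : dotp (i (e n)) (i y) = `|i (e n)| ^+ 2 * dotp (e n) y.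
Proof.
set S := \sum_(k < n) dotp y (e k) *: e k.
have yS : perp (hist n) (y - S).
  by apply: perp_hist => k kn; exact: dotp_sub_fourier_sum.
have S0 : dotp (e n) S = 0 /\ dotp (i (e n)) (i S) = 0.
  rewrite /S linear_sum !dotp_sumr; split; apply: big1 => k _.
    by rewrite dotpZr e_perp// mulr0.
  rewrite linearZ/= dotpZr [dotp (i _) _]dotpC stationary_perp ?mulr0//.
    by rewrite [dotp (e k) _]dotpC e_perp// !mulr0.
  by apply: perp_hist => l lk; rewrite e_perp//; exact: ltn_trans lk (ltn_ord k).
by have := stationary_perp yS; rewrite linearB !dotpBr (proj1 S0) (proj2 S0) !subr0.
Qed.

Let norm_e n : `|e n| <= 1.
Proof. by case: (eP n) => _ [->|->] _; rewrite ?normr0. Qed.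

Let norm_ie_nincr m n : (m <= n)%N -> `|i (e n)| <= `|i (e m)|.
Proof.
move=> mn; have [_ _ /(_ (e n))] := eP m.
move=> /(_ _)/le_trans; apply; last by rewrite ler_piMr.
by apply: perp_hist => k km; rewrite e_perp// (leq_trans km).
Qed.

(** The images [i (e n)] are pairwise orthogonal; if all had norm at least [d], they would stay at
    distance at least [d] from each other, against compactness. *)
Let norm_ie_cvg0 (d : R) : 0 < d -> exists n, `|i (e n)| < d.
Proof.
move=> d0; apply: contrapT => /forallNP nd.
have {}nd n : d <= `|i (e n)| by rewrite leNgt; exact/negP/nd.
have [z [g gP]] := compact_op_subseq ci norm_e.
have d2 : 0 < d / 2 by rewrite divr_gt0.
have [k] := ltr_add_invr d2; rewrite add0r => kd.
(* Evaluating [g] at [(g k).+1] guarantees a second index strictly larger than [a]. *)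
set a := g k; set b := g (g k).+1.
have ab : (a < b)%N by case: (gP (g k).+1).
have da : `|i (e a) - z| < d / 2 by case: (gP k) => _ /lt_trans; apply.
have db : `|i (e b) - z| < d / 2.
  case: (gP (g k).+1) => _ /lt_trans; apply; apply: le_lt_trans kd.
  by rewrite lef_pV2 ?posrE// ler_nat ltnS (leq_trans (proj1 (gP k))).
have : `|i (e a) - i (e b)| < d.
  rewrite (le_lt_trans (ler_distD z _ _))// (distrC z).
  by rewrite [ltRHS]splitr ltrD.
rewrite -(@ltr_pXn2r _ 2) ?nnegrE ?(ltW d0)// normB2.
rewrite dotpC stationary e_perp// !mulr0 subr0.
rewrite ltNge => /negP; apply; apply: ler_wpDr; first exact: sqr_ge0.
by rewrite ler_pXn2r ?nnegrE ?(ltW d0).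
Qed.

(** The remainder of [x] after [N] terms is orthogonal to the first [N] vectors and has norm at most
    [|x|], so its image has norm at most [|i (e N)| |x|], which tends to 0. *)
Lemma singular_system_exists : exists e, singular_system i e.
Proof.
exists e; split => // x.
apply/cvgrPdist_lt => eps eps0.
have c0 : 0 < eps / (`|x| + 1) by rewrite divr_gt0// ltr_wpDl.
have [n nc] := norm_ie_cvg0 c0.
exists n => // N /= nN.
set S := \sum_(k < N) dotp x (e k) *: e k.
have -> : \sum_(k < N) dotp x (e k) *: i (e k) = i S.
  by rewrite linear_sum; apply: eq_bigr => k _; rewrite linearZ.
have [_ _ /(_ (x - S))] := eP N.
rewrite -linearB => /(_ _)/le_lt_trans; apply.
  by apply: perp_hist => k kN; exact: dotp_sub_fourier_sum.
apply: (@le_lt_trans _ _ (`|i (e n)| * `|x|)).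
  by apply: ler_pM => //; [exact: norm_ie_nincr|exact: norm_sub_fourier_sum].
apply: (@le_lt_trans _ _ (`|i (e n)| * (`|x| + 1))).
  by rewrite ler_wpM2l// lerDl.
by rewrite -ltr_pdivlMr// ltr_wpDl.
Qed.

End SingularSystem.

(** * Interpolation *)

(* The sums in the hypothesis are K-functionals at the parameter t in spectral
   form, v k and w k being squared eigenvalues of Lambda. *)
Definition K_transfer (R : realType) (s C : R) : Prop :=
  forall (N G : nat) (v w a b : nat -> R),
    (forall k, 0 <= v k) -> (forall k, 0 <= w k) ->
    (forall k, 0 <= a k) -> (forall k, 0 <= b k) ->
    (forall t, 0 < t -> \sum_(k < N) v k / (v k + t) * b k <=
                        \sum_(k < G) w k / (w k + t) * a k) ->
    \sum_(k < N) v k `^ s * b k <= C * \sum_(k < G) w k `^ s * a k.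

(** * Recovering the power [v^s] from sums over a geometric grid of ratio 4 *)

Section DyadicSums.
Context (R : realType) (s : R).
Hypotheses (s_gt0 : 0 < s) (s_lt1 : s < 1).
Implicit Types (t v : R) (n : nat).

Let p := (4 : R) `^ s.

Let p_gt1 : 1 < p.
Proof.
have : (1 : R) `^ s < 4 `^ s by apply: gt0_ltr_powR; rewrite ?nnegrE//; lra.
by rewrite powR1.
Qed.

Let p_lt4 : p < 4.
Proof.
have h4 : (0 : R) <= 4 by [].
rewrite /p -[ltRHS](powRr1 h4) /powR.
by case: ifPn => [/eqP|_]; [lra|rewrite ltr_expR ltr_pM2r// ln_gt0; lra].
Qed.

Let pow4M t : 0 <= t -> (4 * t) `^ s = p * t `^ s.
Proof. by move=> t0; rewrite powRM. Qed.

(* A discrete version of [int_0^oo t^s v / (v + t) dt / t = c v^s]. *)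
Let dyadic_sum t n v := \sum_(k < n) (t * 4 ^+ k) `^ s * (v / (v + t * 4 ^+ k)).

Let dyadic_sumS t n v :
  dyadic_sum t n.+1 v = t `^ s * (v / (v + t)) + dyadic_sum (4 * t) n v.
Proof.
rewrite /dyadic_sum big_ord_recl expr0 mulr1; congr (_ + _).
apply: eq_bigr => k _.
by have -> : t * 4 ^+ lift ord0 k = 4 * t * 4 ^+ k by rewrite lift0 exprS mulrCA mulrA.
Qed.

(** Bounding [v / (v + t)] by [v / t] leaves a geometric series of ratio [p / 4 < 1], whose sum
    gives the factor [4 / (4 - p)]. *)
Let dyadic_tail t n v : 0 < t -> 0 < v ->
  dyadic_sum t n v <= v / t * t `^ s * (4 / (4 - p)).
Proof.
have p4 : 0 < 4 - p by rewrite subr_gt0.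
elim: n t => [|n IH] t t0 v0.
  by rewrite /dyadic_sum big_ord0 !mulr_ge0 ?powR_ge0 ?invr_ge0 ?ltW.
have t40 : 0 < 4 * t by rewrite mulr_gt0.
rewrite dyadic_sumS; have := IH _ t40 v0; rewrite (pow4M (ltW t0)) => {}IH.
apply: (le_trans (lerD (lexx _) IH)).
have ts : 0 < t `^ s by rewrite powR_gt0.
apply: (@le_trans _ _ (t `^ s * (v / t) + v / (4 * t) * (p * t `^ s) * (4 / (4 - p)))).
  by rewrite lerD2r ler_pM2l// ler_pM2l// lef_pV2 ?posrE ?addr_gt0// lerDr ltW.
rewrite le_eqVlt; apply/orP; left; apply/eqP.
by field; rewrite ?lt0r_neq0.
Qed.

Let sublinear t v : 0 < v -> v <= t -> v / t * t `^ s <= v `^ s.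
Proof.
move=> v0 vt; have t0 : 0 < t by exact: lt_le_trans vt.
have tE : t `^ s = (t / v) `^ s * v `^ s.
  by rewrite -powRM ?divr_ge0 ?(ltW t0) ?(ltW v0)// divfK// lt0r_neq0.
have h : (t / v) `^ s <= t / v.
  rewrite -[leRHS]powRr1 ?divr_ge0 ?(ltW t0) ?(ltW v0)//.
  by apply: ler_powR; rewrite ?(ltW s_lt1)// ler_pdivlMr// mul1r.
rewrite tE mulrA ger_pMl ?powR_gt0// -invf_div mulrC.
by rewrite ler_pdivrMr ?divr_gt0// mul1r.
Qed.

(** The extra term [t^s / (p - 1)] makes the induction close: adding [t^s] to it gives exactly
    [(4 t)^s / (p - 1)]. The three summands of the constant pay for the last grid point below [v],
    the tail above [v], and this extra term. *)
Let dyadic_head t n v : 0 < t -> t <= v ->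
  dyadic_sum t n v + t `^ s / (p - 1) <= (1 + 4 / (4 - p) + (p - 1)^-1) * v `^ s.
Proof.
have p4 : 0 < 4 - p by rewrite subr_gt0.
have p1 : 0 < p - 1 by rewrite subr_gt0.
elim: n t => [|n IH] t t0 tv; have v0 := lt_le_trans t0 tv.
all: have ts : 0 < t `^ s by rewrite powR_gt0.
all: have vs : 0 < v `^ s by rewrite powR_gt0.
all: have tvs : t `^ s <= v `^ s by apply: ge0_ler_powR; rewrite ?nnegrE ?(ltW t0)
  ?(ltW v0) ?(ltW s_gt0).
all: have c0 : 0 < 4 / (4 - p) by rewrite divr_gt0.
all: have tvp : t `^ s / (p - 1) <= v `^ s * (p - 1)^-1 by rewrite ler_pM2r ?invr_gt0.
  rewrite /dyadic_sum big_ord0 add0r.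
  have := mulr_ge0 (ltW c0) (ltW vs); lra.
have t40 : 0 < 4 * t by rewrite mulr_gt0.
have h : t `^ s * (v / (v + t)) <= t `^ s.
  by rewrite ler_piMr ?(ltW ts) ?(ltW v0)// ler_pdivrMr ?addr_gt0// mul1r lerDl (ltW t0).
rewrite dyadic_sumS; have [tv4|tv4] := leP (4 * t) v.
  have := IH _ t40 tv4; rewrite (pow4M (ltW t0)).
  have -> : p * t `^ s / (p - 1) = t `^ s + t `^ s / (p - 1).
    by field; rewrite lt0r_neq0.
  lra.
have h1 := dyadic_tail n t40 v0.
have h2 : v / (4 * t) * (4 * t) `^ s * (4 / (4 - p)) <= v `^ s * (4 / (4 - p)).
  by rewrite ler_pM2r// sublinear// ltW.
lra.
Qed.

Let dyadic_sum_le : exists2 C, 0 < C &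
  forall t n v, 0 < t -> 0 <= v -> dyadic_sum t n v <= C * v `^ s.
Proof.
have p4 : 0 < 4 - p by rewrite subr_gt0.
have p1 : 0 < p - 1 by rewrite subr_gt0.
have c0 : 0 < 4 / (4 - p) by rewrite divr_gt0.
have d0 : 0 < (p - 1)^-1 by rewrite invr_gt0.
exists (1 + 4 / (4 - p) + (p - 1)^-1); first by rewrite !addr_gt0.
move=> t n v t0; rewrite le_eqVlt => /predU1P[<-|v0].
  rewrite powR0 ?lt0r_neq0// mulr0 /dyadic_sum big1// => k _.
  by rewrite mul0r mulr0.
have vs : 0 < v `^ s by rewrite powR_gt0.
have [tv|vt] := leP t v.
  have := dyadic_head n t0 tv.
  have : 0 < t `^ s / (p - 1) by rewrite divr_gt0// powR_gt0.
  lra.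
apply: (le_trans (dyadic_tail n t0 v0)).
apply: (@le_trans _ _ (v `^ s * (4 / (4 - p)))).
  by rewrite ler_pM2r// sublinear// ltW.
rewrite mulrC ler_pM2r//; lra.
Qed.

(** One grid point is enough: where [t <= v < 4 t], the fraction [v / (v + t)] is at least 1/2 and
    [v^s <= p t^s]. *)
Let dyadic_sum_ge t n v : 0 < t -> t <= v -> v < t * 4 ^+ n ->
  v `^ s <= 2 * p * dyadic_sum t n v.
Proof.
elim: n t => [|n IH] t t0 tv; have v0 := lt_le_trans t0 tv.
  by rewrite expr0 mulr1 ltNge tv.
have t40 : 0 < 4 * t by rewrite mulr_gt0.
have p0 : 0 < p by rewrite powR_gt0.
rewrite exprS mulrA (mulrC t) => vt; rewrite dyadic_sumS mulrDr.
have [tv4|tv4] := leP (4 * t) v.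
  apply: ler_wpDl; last exact: IH.
  by rewrite !mulr_ge0 ?powR_ge0 ?invr_ge0 ?addr_ge0 ?(ltW p0) ?(ltW v0) ?(ltW t0).
apply: ler_wpDr.
  apply: mulr_ge0; first by rewrite mulr_ge0 ?(ltW p0).
  apply: sumr_ge0 => k _.
  by rewrite !mulr_ge0 ?powR_ge0 ?invr_ge0 ?addr_ge0 ?mulr_ge0 ?exprn_ge0 ?(ltW v0) ?(ltW t0).
have h : v `^ s <= p * t `^ s.
  rewrite -(pow4M (ltW t0)).
  by apply: ge0_ler_powR; rewrite ?nnegrE ?(ltW t40) ?(ltW v0) ?(ltW tv4) ?(ltW s_gt0).
apply: (le_trans h); rewrite (mulrC 2) -!mulrA ler_pM2l//.
rewrite mulrCA ler_peMr ?powR_ge0// mulrA ler_pdivlMr ?addr_gt0//.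
lra.
Qed.

Let dyadic_range N (v : nat -> R) : exists t n, 0 < t /\
  forall k, (k < N)%N -> 0 < v k -> t <= v k < t * 4 ^+ n.
Proof.
have [t t0 tv] : exists2 t, 0 < t & forall k, (k < N)%N -> 0 < v k -> t <= v k.
  elim: N => [|N [t t0 IH]]; first by exists 1.
  have [vN|vN] := leP (v N) 0.
    exists t => // k; rewrite ltnS leq_eqVlt => /predU1P[->|/IH//].
    by rewrite ltNge vN.
  exists (Num.min t (v N)); first by rewrite lt_min t0.
  move=> k; rewrite ltnS leq_eqVlt => /predU1P[-> _|kN vk].
    by rewrite ge_min lexx orbT.
  by rewrite ge_min IH.
pose B := \sum_(k < N) `|v k|.
(* [B] bounds every [v k], and [B / t < n <= 4^n] for this [n]. *)
exists t, (Num.truncn (B / t)).+1; split=> // k kN vk; rewrite tv//=.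
have vB : v k <= B.
  rewrite /B (bigD1 (Ordinal kN))//= ler_wpDr ?sumr_ge0// ?ler_norm//.
apply: le_lt_trans vB _; rewrite mulrC -ltr_pdivrMr//.
apply: lt_le_trans (truncnS_gt _) _.
by rewrite -natrX ler_nat ltnW// ltn_expl.
Qed.

(* Integrating the inequality for all t against [t^s dt / t] gives the one for
   powers. *)
Lemma K_method : exists2 C, 0 < C & K_transfer s C.
Proof.
have [C C0 CP] := dyadic_sum_le.
have p0 : 0 < 2 * p by rewrite mulr_gt0// powR_gt0.
exists (2 * p * C); first by rewrite mulr_gt0.
move=> N G v w a b v0 w0 a0 b0 vw.
(* The grid is adapted to [v] alone; the upper bound applied later to [w] holds on every grid. *)
have [t [n [t0 tP]]] := dyadic_range N v.
have swap M (u c : nat -> R) : \sum_(k < M) dyadic_sum t n (u k) * c k =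
    \sum_(j < n) (t * 4 ^+ j) `^ s * \sum_(k < M) u k / (u k + t * 4 ^+ j) * c k.
  under eq_bigr do rewrite mulr_suml.
  rewrite exchange_big/=; apply: eq_bigr => j _.
  by rewrite mulr_sumr; apply: eq_bigr => k _; rewrite -mulrA.
apply: (@le_trans _ _ (2 * p * \sum_(k < N) dyadic_sum t n (v k) * b k)).
  rewrite mulr_sumr; apply: ler_sum => k _; rewrite mulrA ler_wpM2r//.
  have := v0 k; rewrite le_eqVlt => /predU1P[<-|vk].
    rewrite powR0 ?lt0r_neq0//; apply: mulr_ge0; first exact: ltW.
    by rewrite /dyadic_sum sumr_ge0// => j _; rewrite mul0r mulr0. 
  have /andP[] := tP _ (ltn_ord k) vk.
  exact: dyadic_sum_ge.
rewrite -(mulrA (2 * p)) ler_pM2l// swap.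
apply: (@le_trans _ _ (\sum_(k < G) dyadic_sum t n (w k) * a k)).
  rewrite swap; apply: ler_sum => j _; rewrite ler_wpM2l ?powR_ge0// vw//.
  by rewrite mulr_gt0// exprn_gt0.
rewrite mulr_sumr; apply: ler_sum => k _.
by rewrite mulrA ler_wpM2r// CP.
Qed.

End DyadicSums.

(** A point [i x] closer to [y] than [|y|] would contradict
    [|y|^2 = <y, y - i x> <= |y| |y - i x|]. *)
Lemma dense_orth (R : realType) (H K : hilbertType R) (i : K -> H) y :
  dense (range i) -> (forall x, dotp y (i x) = 0) -> y = 0.
Proof.
move=> di yi; apply: dotp_eq0; apply/eqP.
rewrite dotp_norm sqrf_eq0 normr_eq0 -normr_le0.
apply/ler_addgt0Pr => eps eps0; rewrite add0r leNgt; apply/negP => ye.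
have [||z [yz [x _ xz]]] := di (ball y eps).
- by exists y; exact: ballxx.
- exact: ball_open.
have : `|y| ^+ 2 <= `|y| * `|y - i x|.
  rewrite -dotp_norm -[dotp y y]subr0 -(yi x) -dotpBr.
  exact: le_trans (ler_norm _) (cauchy_schwarz _ _).
rewrite expr2 ler_pM2l ?(lt_trans eps0)// leNgt => /negP; apply.
by move: yz; rewrite -ball_normE/= -xz => /lt_trans; apply.
Qed.

(** * Spectral description of [Lambda] and its powers by singular vectors *)

Section SingularBasis.
Context (R : realType) (K0 K1 : hilbertType R) (i : {linear K1 -> K0}).
Context (e : nat -> K1).
Hypotheses (ci : compact_op i) (ii : injective i) (di : dense (range i)).
Hypothesis se : singular_system i e.

(** The eigenvalue of [Lambda] at [e n]. If [e n = 0], the convention that 0 has inverse 0 makes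
    both [sing_val n] and [sing_vec n] zero. *)
Definition sing_val n := `|i (e n)|^-1.
Definition sing_vec n := sing_val n *: i (e n).
Local Notation lam := sing_val.
Local Notation f := sing_vec.

Let eo : orthonormal0 e. Proof. by case: se. Qed.

Lemma sing_val_ge0 n : 0 <= lam n. Proof. by rewrite invr_ge0. Qed.

Let eP n : e n = 0 \/ (`|e n| = 1 /\ `|i (e n)| != 0).
Proof.
case: eo => _ /(_ n)[->|e1]; [by left|right; split=> //].
rewrite normr_eq0; apply/eqP => ie0; have e0 : e n = 0 by apply: ii; rewrite linear0.
by move: e1; rewrite e0 normr0 => /eqP; rewrite eq_sym oner_eq0.
Qed.

Let ie_f n : i (e n) = `|i (e n)| *: f n.
Proof.
rewrite /f /lam; case: (eP n) => [->|[_ n0]]; first by rewrite linear0 !scaler0.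
by rewrite scalerA divff// scale1r.
Qed.

Lemma sing_vec_orthonormal : orthonormal0 f.
Proof.
have [of' _] := eo; split=> [m n mn|n].
  rewrite dotpZl dotpZr; case: se => _ -> _.
  by rewrite of'// !mulr0.
rewrite /f /lam; case: (eP n) => [->|[_ n0]]; first by left; rewrite linear0 scaler0.
by right; rewrite normrZ normfV normr_id mulVf.
Qed.
Local Notation fo := sing_vec_orthonormal.

Lemma dotp_sing_vec n x : dotp (i x) (f n) = `|i (e n)| * dotp x (e n).
Proof.
rewrite dotpZr dotpC; case: se => _ -> _; rewrite dotpC mulrA; congr (_ * _).
rewrite /lam; have [->|n0] := eqVneq `|i (e n)| 0; first by rewrite expr0n mulr0.
by rewrite expr2 mulrA mulVf// mul1r.
Qed.

Let dotp_ff k n : dotp (f k) (f n) = dotp (e k) (e n).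
Proof.
rewrite dotpZl dotp_sing_vec mulrA; have [->|kn] := eqVneq k n.
  by rewrite /lam; case: (eP n) => [->|[_ n0]]; rewrite ?dotp0l ?mulr0// mulVf// mul1r.
by case: eo => oe _; rewrite oe ?mulr0.
Qed.

(** Every [i x] is a limit of combinations of the [f n], and the range of [i] is dense. *)
Let sing_vec_total y : (forall n, dotp y (f n) = 0) -> y = 0.
Proof.
move=> yf; apply: (dense_orth di) => x; case: se => _ _ /(_ x) ex.
apply: (@cvg_seq_cst R R^o _ _ _ (cvg_dotpr (z := y) ex)) => N.
by rewrite dotp_sumr big1// => k _; rewrite dotpZr ie_f dotpZr yf !mulr0.
Qed.

Let fourier_limit (H : hilbertType R) (g : nat -> H) (go : orthonormal0 g) c y :
  (forall k, g k = 0 -> c k = 0) ->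
  (fun N => \sum_(k < N) c k *: g k) @ \oo --> y ->
  forall n, dotp y (g n) = c n.
Proof.
move=> c0 cy n; have h := cvg_dotpl (z := g n) cy.
(* Once the partial sums contain the term [n], their pairing with [g n] is constantly [c n]. *)
move: h; rewrite -(cvg_shiftn n.+1) => h.
apply: (@cvg_seq_cst R R^o _ _ _ h) => N.
by rewrite /= (dotp_fourier_sum go)// addnS ltnS leq_addl.
Qed.

Lemma sing_vec_expansion y :
  (fun N => \sum_(k < N) dotp y (f k) *: f k) @ \oo --> y.
Proof.
have [y' yy'] := fourier_series_cvg fo y.
suff /eqP : y' - y = 0 by rewrite subr_eq0 => /eqP yE; rewrite yE in yy'.
apply: sing_vec_total => n; rewrite dotpBl; apply/eqP; rewrite subr_eq0; apply/eqP.
apply: (@fourier_limit _ _ fo (fun k => dotp y (f k)) _ _ yy') => k ->.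
by rewrite dotp0r.
Qed.

Let e_total x : (forall n, dotp x (e n) = 0) -> x = 0.
Proof.
move=> xe; apply: ii; rewrite linear0; case: se => _ _ /(_ x).
move=> ex; apply: (cvg_seq_cst ex) => N.
by rewrite big1// => k _; rewrite xe scale0r.
Qed.

Let e_expansion x : (fun N => \sum_(k < N) dotp x (e k) *: e k) @ \oo --> x.
Proof.
have [x' xx'] := fourier_series_cvg eo x.
suff /eqP : x' - x = 0 by rewrite subr_eq0 => /eqP xE; rewrite xE in xx'.
apply: e_total => n; rewrite dotpBl; apply/eqP; rewrite subr_eq0; apply/eqP.
apply: (@fourier_limit _ _ eo (fun k => dotp x (e k)) _ _ xx') => k ->.
by rewrite dotp0r.
Qed.

Let f_eq0 n : f n = 0 -> e n = 0.
Proof.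
case: (eP n) => // -[_ n0] fn0; apply: ii.
by rewrite ie_f fn0 scaler0 linear0.
Qed.

(** First the square: [L e_n] lies in the domain and [L] maps it to [l^2 i e_n]. Positivity then
    excludes the root [-l]. *)
Let is_Lambda_eigen (L : {linear K1 -> K0}) n : is_Lambda i L ->
  L (e n) = lam n *: i (e n).
Proof.
move=> [Lsym Lpos Ldom Liso].
case: (eP n) => [->|[_ n0]]; first by rewrite !linear0.
have Ldot x y : dotp (L x) (L y) = dotp x y.
  have := Liso (x + y); move=> /(congr1 (fun r => r ^+ 2)).
  rewrite linearD !normD2 !Liso => h; lra.
set l := lam n.
have l0 : 0 < l by rewrite invr_gt0 lt_def n0 normr_ge0.
(* [L] is isometric, so the singular relation puts [L (e n)] in the domain of the adjoint; the third
   clause of [is_Lambda] then produces [y1] with [L (e n) = i y1]. *)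
have eigen2 x : dotp (L x) (L (e n)) = dotp (i x) (l ^+ 2 *: i (e n)).
  rewrite Ldot dotpZr [dotp (i x) _]dotpC; case: se => _ -> _.
  by rewrite mulrA -exprMn mulVf// expr1n mul1r dotpC.
have [y1 y1E] := Ldom _ _ eigen2.
have Ly1 : L y1 = l ^+ 2 *: i (e n).
  apply/eqP; rewrite -subr_eq0; apply/eqP; apply: (dense_orth di) => x.
  rewrite dotpC dotpBr -eigen2 y1E; have := Lsym x y1 => <-.
  by rewrite subrr.
have := Lpos (y1 - l *: e n).
have -> : L (y1 - l *: e n) = - l *: i (y1 - l *: e n).
  rewrite linearB linearZ/= Ly1 [i (_ - _)]linearB [i (l *: _)]linearZ/= -y1E.
  by rewrite scaleNr scalerBr scalerA -expr2 opprB.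
rewrite dotpZl dotp_norm mulNr oppr_ge0 pmulr_rle0// => h.
have : i (y1 - l *: e n) = 0.
  by apply/eqP; rewrite -normr_eq0 -sqrf_eq0 eq_le h sqr_ge0.
by rewrite linearB/= linearZ/= y1E => /eqP; rewrite subr_eq0 => /eqP.
Qed.

(** The witness sends [x] to the sum of [<x, e_k> f_k]; each clause is checked on coefficients. *)
Let is_Lambda_exists : exists L : {linear K1 -> K0}, is_Lambda i L.
Proof.
have /choice[L LP] : forall x : K1, exists y : K0,
    (fun N => \sum_(k < N) dotp x (e k) *: f k) @ \oo --> y.
  move=> x; have xe N := bessel eo N x.
  by have [y] := fourier_sum_cvg fo (c := fun k => dotp x (e k)) xe; exists y.
have Lf x n : dotp (L x) (f n) = dotp x (e n).
  apply: (@fourier_limit _ _ fo (fun k => dotp x (e k)) _ _ (LP x)) => k /f_eq0 ->.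
  by rewrite dotp0r.
have Llin : linear L.
  move=> a x y; apply/eqP; rewrite -subr_eq0; apply/eqP.
  apply: sing_vec_total => n.
  by rewrite dotpBl dotpDl dotpZl !Lf dotpDl dotpZl subrr.
have dotL x z :
    (fun N => \sum_(k < N) dotp x (e k) * dotp (f k) z) @ \oo --> dotp (L x) z.
  have := @cvg_dotpl _ _ _ _ z (LP x).
  by under eq_fun do (rewrite dotp_suml; under eq_bigr do rewrite dotpZl).
have dotLi x y :
    (fun N => \sum_(k < N) `|i (e k)| * (dotp x (e k) * dotp y (e k))) @ \oo -->
    dotp (L x) (i y).
  have := dotL x (i y).
  by under eq_fun do under eq_bigr do rewrite [dotp (f _) _]dotpC dotp_sing_vec mulrCA.

pose LL : {linear K1 -> K0} := HB.pack L (GRing.isLinear.Build _ _ _ _ L Llin).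
have cvg_sum_ge0 (u : nat -> R) l : (forall k, 0 <= u k) ->
    (fun N => \sum_(k < N) u k) @ \oo --> l -> 0 <= l.
  move=> u0 ul; rewrite -oppr_le0; apply: (cvg_le_bound (cvgN ul)) => N.
  by rewrite oppr_le0 sumr_ge0.
exists LL; split=> [x y|x|y z yz|x] /=.
- rewrite [RHS]dotpC; apply: (@cvg_seq_unique R R^o _ _ _ _ (dotLi x y) (dotLi y x)) => N.
  by apply: eq_bigr => k _; rewrite (mulrC (dotp x _)).
- pose c k := `|i (e k)| * (dotp x (e k) * dotp x (e k)).
  apply: (cvg_sum_ge0 c) (dotLi x x) => k.
  by rewrite mulr_ge0// -expr2 sqr_ge0.
(* The preimage of [y] is the sum of [<z, f_k> e_k]. Testing the adjoint relation on [e_k], where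
   [L e_k = f_k], gives [<y, f_k> = |i e_k| <z, f_k>]. *)
- have zf N := bessel fo N z.
  have [y1 y1E _] := fourier_sum_cvg eo (c := fun k => dotp z (f k)) zf.
  exists y1.
  apply: (cvg_seq_unique (@sing_vec_expansion y) (cvg_linear ci y1E)) => N.
  rewrite linear_sum; apply: eq_bigr => k _.
  rewrite [i (_ *: _)]linearZ/= [in RHS]ie_f [RHS]scalerA.
  congr (_ *: _); rewrite dotpC.
  have fL : f k = L (e k).
    apply/eqP; rewrite -subr_eq0; apply/eqP; apply: sing_vec_total => n.
    by rewrite dotpBl Lf dotp_ff subrr.
  by rewrite [in LHS]fL yz [in LHS]ie_f dotpZl mulrC dotpC.
- apply/eqP; rewrite -(@eqrXn2 _ 2)// -!dotp_norm; apply/eqP.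
  have xx : (fun N => \sum_(k < N) dotp x (e k) * dotp x (e k)) @ \oo --> dotp x x.
    have := cvg_dotpl (z := x) (@e_expansion x).
    under eq_fun do (rewrite dotp_suml;
      under eq_bigr do rewrite dotpZl [dotp (e _) _]dotpC).
    by [].
  apply: (@cvg_seq_unique R R^o _ _ _ _ (dotL x (L x)) xx) => N.
  by apply: eq_bigr => k _; rewrite [dotp (f _) _]dotpC Lf.
Qed.

Lemma Lambda_is_Lambda : is_Lambda i (Lambda i).
Proof. by have [L] := is_Lambda_exists; rewrite /Lambda; exact: getI. Qed.

(** Testing on the singular vectors suffices: if [e'] has eigenvalue [l], symmetry of [Lambda] shows
    that [i e'] has nonzero coefficients only along those [f n] with [lam n = l]. *)
Lemma Lambda_powP s x y :
  Lambda_pow i s x y <-> forall n, dotp y (f n) = lam n `^ s * dotp x (f n).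
Proof.
have [Lsym _ _ _] := Lambda_is_Lambda.
have Le n : Lambda i (e n) = lam n *: i (e n).
  exact: is_Lambda_eigen Lambda_is_Lambda.
split=> [xy n|yf e' l e'l].
  have fE : f n = i (lam n *: e n) by rewrite linearZ.
  rewrite fE; apply: xy.
  by rewrite !linearZ/= Le scalerA.
set w := i e'.
have lw n : l * dotp w (f n) = lam n * dotp w (f n).
  have := Lsym e' (lam n *: e n); rewrite e'l linearZ/= dotpZl => ->.
  by rewrite linearZ/= Le -/(f n) dotpZr.
have h z : (fun N => \sum_(k < N) dotp w (f k) * dotp z (f k)) @ \oo --> dotp z w.
  have := cvg_dotpr (z := z) (@sing_vec_expansion w).
  by under eq_fun do (rewrite dotp_sumr; under eq_bigr do rewrite dotpZr).
have h2 : (fun N => l `^ s * \sum_(k < N) dotp w (f k) * dotp x (f k)) @ \oo -->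
    l `^ s * dotp x w.
  by apply: cvgM (h x); exact: cvg_cst.
apply: (@cvg_seq_unique R R^o _ _ _ _ (h y) h2) => N.
rewrite mulr_sumr; apply: eq_bigr => k _; rewrite yf mulrCA.
have [->|w0] := eqVneq (dotp w (f k)) 0; first by rewrite !mul0r ?mulr0.
by have /(mulIf w0) -> := lw k.
Qed.

Lemma Lambda_pow_unique s x y y' :
  Lambda_pow i s x y -> Lambda_pow i s x y' -> y = y'.
Proof.
move=> /Lambda_powP xy /Lambda_powP xy'.
apply/eqP; rewrite -subr_eq0; apply/eqP; apply: sing_vec_total => n.
by rewrite dotpBl xy xy' subrr.
Qed.

Lemma interp_normE s (x : interp i s) y : Lambda_pow i s x y -> interp_norm x = `|y|.
Proof.
move=> xy; rewrite /interp_norm (xget_unique _ (x := y))//.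
by move=> y' xy'; exact: Lambda_pow_unique xy' xy.
Qed.

(** * Operators bounded on both ends act on the interpolation space *)

Section Pair.
Context (A0 : {linear K0 -> K0}) (A1 : {linear K1 -> K1}) (M : R).
Hypotheses (M0 : 0 <= M) (A0M : forall x, `|A0 x| <= M * `|x|).
Hypothesis A1M : forall x, `|A1 x| <= M * `|x|.
Hypothesis A01 : forall x, A0 (i x) = i (A1 x).

Let v n := lam n ^+ 2.

(* The K-functional estimate at parameter t: split x = (x - i x1) + i x1 with
   the coefficients of x1 minimising |x - i x1|^2 + |x1|^2 / t, and apply A0 to
   the first part and A1 to x1. *)
Let K_functional (G F : nat) (a : nat -> R) t : 0 < t ->
  (forall k, f k = 0 -> a k = 0) ->
  \sum_(n < F) v n / (v n + t) * dotp (A0 (\sum_(m < G) a m *: f m)) (f n) ^+ 2 <=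
  \sum_(m < G) v m / (v m + t) * (M ^+ 2 * a m ^+ 2).
Proof.
move=> t0 a0; set x := \sum_(m < G) a m *: f m.
have vt k : v k + t != 0 by rewrite lt0r_neq0// ltr_wpDl// sqr_ge0.
pose c k := t / (v k + t) * a k.
pose x1 := \sum_(m < G) (c m * lam m) *: e m.
pose u := A0 (x - i x1); pose w := A1 x1.
have AxE : A0 x = u + i w by rewrite -A01 /u linearB subrK.
have xx1 : `|x - i x1| ^+ 2 <= \sum_(m < G) (v m / (v m + t) * a m) ^+ 2.
  apply: le_trans (norm2_fourier_sum_ord fo G (fun m => v m / (v m + t) * a m)).
  rewrite /x /x1 linear_sum -sumrB.
  rewrite (eq_bigr (fun m : 'I_G => (v m / (v m + t) * a m) *: f m))// => m _.
  have -> : i ((c m * lam m) *: e m) = c m *: f m by rewrite [LHS]linearZ/= -scalerA.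
  by rewrite -scalerBl /c; congr (_ *: _); field.
have nx1 : `|x1| ^+ 2 <= \sum_(m < G) (c m * lam m) ^+ 2.
  exact: (norm2_fourier_sum_ord eo G (fun m => c m * lam m)).
(* The gap in [v / (v + t) (p + q)^2 <= p^2 + v q^2 / t] is the square
   [(t p - v q)^2 / (t (v + t))]; the weight [v n] turns the coefficient of [i w] along [f n] into
   that of [w] along [e n]. *)
have term n : v n / (v n + t) * dotp (A0 x) (f n) ^+ 2 <=
    dotp u (f n) ^+ 2 + t^-1 * dotp w (e n) ^+ 2.
  rewrite AxE dotpDl; set p := dotp u _; set q := dotp (i w) _.
  have v0 : 0 <= v n by exact: sqr_ge0.
  have vq : v n * q ^+ 2 <= dotp w (e n) ^+ 2.
    rewrite /q dotp_sing_vec /v -exprMn mulrA exprMn.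
    rewrite ler_piMl ?sqr_ge0// /lam; case: (eP n) => [->|[_ n0]].
      by rewrite linear0 normr0 mulr0 expr0n.
    by rewrite mulVf// expr1n.
  apply: (@le_trans _ _ (p ^+ 2 + t^-1 * (v n * q ^+ 2))); last first.
    by rewrite lerD2l ler_pM2l ?invr_gt0.
  rewrite -subr_ge0.
  have -> : p ^+ 2 + t^-1 * (v n * q ^+ 2) - v n / (v n + t) * (p + q) ^+ 2 =
      (t * p - v n * q) ^+ 2 / (t * (v n + t)).
    by field; rewrite (lt0r_neq0 t0) vt.
  by rewrite divr_ge0 ?sqr_ge0// mulr_ge0 ?addr_ge0// ltW.
apply: (@le_trans _ _ (\sum_(n < F) (dotp u (f n) ^+ 2 + t^-1 * dotp w (e n) ^+ 2))).
  by apply: ler_sum => n _; exact: term.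
rewrite big_split/= -mulr_sumr.
have u2 : `|u| ^+ 2 <= M ^+ 2 * `|x - i x1| ^+ 2.
  by rewrite -exprMn ler_pXn2r ?nnegrE ?mulr_ge0//; exact: A0M.
have w2 : `|w| ^+ 2 <= M ^+ 2 * `|x1| ^+ 2.
  by rewrite -exprMn ler_pXn2r ?nnegrE ?mulr_ge0//; exact: A1M.
apply: (@le_trans _ _ (M ^+ 2 * (\sum_(m < G) (v m / (v m + t) * a m) ^+ 2) +
    t^-1 * (M ^+ 2 * \sum_(m < G) (c m * lam m) ^+ 2))).
  apply: lerD.
    apply: le_trans (bessel fo F u) _; apply: (le_trans u2).
    by rewrite ler_wpM2l ?sqr_ge0.
  rewrite ler_pM2l ?invr_gt0//.
  apply: le_trans (bessel eo F w) _; apply: (le_trans w2).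
  by rewrite ler_wpM2l ?sqr_ge0.
(* The splitting is optimal: [(v / (v + t))^2 + t^-1 v (t / (v + t))^2 = v / (v + t)]. *)
rewrite !mulr_sumr -big_split/= le_eqVlt; apply/orP; left; apply/eqP.
apply: eq_bigr => m _; rewrite /c [(_ * lam m) ^+ 2]exprMn -/(v m).
by field; rewrite (lt0r_neq0 t0) vt.
Qed.

(** The K-functional estimate covers finite combinations of the [f m]; continuity of [A0] carries it
    over to their limit [x]. *)
Let coef_cvg (a : nat -> R) x F : (fun G => \sum_(n < F) a n * dotp (A0
    (\sum_(m < G) dotp x (f m) *: f m)) (f n) ^+ 2) @ \oo -->
    \sum_(n < F) a n * dotp (A0 x) (f n) ^+ 2.
Proof.
have A0x : (fun G => A0 (\sum_(m < G) dotp x (f m) *: f m)) @ \oo --> A0 x.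
  apply/cvgrPdist_le => eps eps0.
  have d0 : 0 < eps / (M + 1) by rewrite divr_gt0// ltr_wpDl.
  have := @sing_vec_expansion x; move/cvgrPdist_le/(_ _ d0); apply: filterS => G xG.
  rewrite -linearB (le_trans (A0M _))// (le_trans (ler_wpM2l M0 xG))//.
  by rewrite mulrCA ler_piMr ?(ltW eps0)// ler_pdivrMr ?ltr_wpDl// mul1r lerDl.
elim: F => [|F IH].
  by under eq_fun do rewrite big_ord0; rewrite big_ord0; exact: cvg_cst.
under eq_fun do rewrite big_ord_recr/=; rewrite big_ord_recr/=.
apply: cvgD => //; apply: cvgM; first exact: cvg_cst.
by apply: cvgM; exact: cvg_dotpl.
Qed.

Lemma sing_coef_le s C x B F : 0 < s ->
  K_transfer s C ->
  0 <= C ->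
  (forall G, \sum_(m < G) (lam m `^ s * dotp x (f m)) ^+ 2 <= B) ->
  \sum_(n < F) (lam n `^ s * dotp (A0 x) (f n)) ^+ 2 <= C * M ^+ 2 * B.
Proof.
move=> s0 CP C0 xB.
have vE k : v k `^ s = (lam k `^ s) ^+ 2.
  by rewrite /v expr2 powRM ?sing_val_ge0.
under eq_bigr do rewrite exprMn -vE.
have h := (@coef_cvg (fun n => v n `^ s) x F); apply: (cvg_le_bound h) => G.
have v0 k : 0 <= v k by exact: sqr_ge0.
apply: (le_trans (CP F G v v (fun m => M ^+ 2 * dotp x (f m) ^+ 2)
  (fun n => dotp (A0 (\sum_(m < G) dotp x (f m) *: f m)) (f n) ^+ 2) v0 v0 _ _ _)).
- by move=> k; rewrite mulr_ge0 ?sqr_ge0.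
- by move=> k; rewrite sqr_ge0.
- move=> t t0; apply: (@K_functional G F (fun m => dotp x (f m))) => // k ->.
  by rewrite dotp0r.
rewrite -mulrA ler_wpM2l//.
under eq_bigr do rewrite mulrCA vE -exprMn.
by rewrite -mulr_sumr ler_wpM2l ?sqr_ge0.
Qed.

End Pair.

(** Square-summability of the weighted coefficients of [A0 x] yields [Lambda^s (A0 x)] by
    Riesz-Fischer. [C] is chosen before the operators, so that the estimate also applies to
    differences of operators. *)
Lemma interp_map s : 0 <= s -> s < 1 -> exists2 C, 0 <= C &
  forall (A0 : {linear K0 -> K0}) (A1 : {linear K1 -> K1}) M, 0 <= M ->
    (forall x, `|A0 x| <= M * `|x|) -> (forall x, `|A1 x| <= M * `|x|) ->
    (forall x, A0 (i x) = i (A1 x)) ->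
  forall x : interp i s, exists2 y : interp i s,
    interp_val y = A0 (interp_val x) & interp_norm y <= C * M * interp_norm x.
Proof.
move=> s0 s1.
have [C C0 CP] : exists2 C, 0 < C &
  forall (A0 : {linear K0 -> K0}) (A1 : {linear K1 -> K1}) M, 0 <= M ->
    (forall x, `|A0 x| <= M * `|x|) -> (forall x, `|A1 x| <= M * `|x|) ->
    (forall x, A0 (i x) = i (A1 x)) -> forall x B F,
  (forall G, \sum_(m < G) (lam m `^ s * dotp x (f m)) ^+ 2 <= B) ->
  \sum_(n < F) (lam n `^ s * dotp (A0 x) (f n)) ^+ 2 <= C * M ^+ 2 * B.
  (* The K-method needs [0 < s]. At [s = 0] all weights are 1 and boundedness on [K0] is enough. *)
  move: s0; rewrite le_eqVlt => /predU1P[<-|s0].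
    exists 1 => // A0 A1 M M0 A0M _ _ x B F xB.
    under eq_bigr do rewrite powRr0 mul1r.
    rewrite (le_trans (bessel fo F (A0 x)))// mul1r.
    apply: (@le_trans _ _ (M ^+ 2 * `|x| ^+ 2)).
      by rewrite -exprMn ler_pXn2r ?nnegrE ?mulr_ge0//; exact: A0M.
    rewrite ler_wpM2l ?sqr_ge0//.
    have xB' N : \sum_(k < N) dotp x (f k) ^+ 2 <= B.
      by have := xB N; under eq_bigr do rewrite powRr0 mul1r.
    have [y xy] := fourier_sum_cvg fo (c := fun k => dotp x (f k)) xB'.
    by rewrite (cvg_seq_unique xy (@sing_vec_expansion x) (fun=> erefl)).
  have [C C0 CP] := K_method s0 s1.
  exists C => // A0 A1 M M0 A0M A1M A01 x B F xB.
  exact: (sing_coef_le M0 A0M A1M A01 F s0 CP (ltW C0) xB).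
(* The squared norms are compared with constant [C], and [C <= (C + 1)^2] avoids a square root. *)
exists (C + 1); first by rewrite addr_ge0// ltW.
move=> A0 A1 M M0 A0M A1M A01 x.
have /asboolP[w xw] := valP x.
rewrite (interp_normE xw).
have wE n : dotp w (f n) = lam n `^ s * dotp (interp_val x) (f n).
  by move/Lambda_powP : xw; apply.
have xB G : \sum_(m < G) (lam m `^ s * dotp (interp_val x) (f m)) ^+ 2 <= `|w| ^+ 2.
  by under eq_bigr do rewrite -wE; exact: (bessel fo G w).
pose c n := lam n `^ s * dotp (A0 (interp_val x)) (f n).
have [y yc yB] := fourier_sum_cvg fo (c := c) (fun F => CP _ _ _ M0 A0M A1M A01 _ _ F xB).
have xy : Lambda_pow i s (A0 (interp_val x)) y.
  apply/Lambda_powP => n; apply: (@fourier_limit _ _ fo c _ _ yc) => k fk.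
  by rewrite /c fk dotp0r mulr0.
have yd : A0 (interp_val x) \in pow_dom i s by apply/asboolP; exists y.
exists (Interp yd) => //; rewrite (interp_normE (x := Interp yd) xy).
rewrite -(@ler_pXn2r _ 2) ?nnegrE ?mulr_ge0 ?addr_ge0 ?(ltW C0)//.
apply: (le_trans yB); rewrite !exprMn ler_wpM2r ?sqr_ge0//.
rewrite ler_wpM2r ?sqr_ge0//; nra.
Qed.

End SingularBasis.

(** * Composition of bounded operators and chain rules *)

(** The bound has the shape left by telescoping a product, [(a - f) g + a (b - g)]; it gives joint
    continuity without a bilinear map on a common type. *)
Lemma cvg_by_product_bound (R : realType) (T : Type) (F : set_system T)
    (FF : ProperFilter F) (U V W : normedModType R) (f : T -> U) (g : T -> V)
    (h : T -> W) a b c (C : R) :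
  f @ F --> a -> g @ F --> b ->
  (\forall t \near F,
    `|c - h t| <= C * (`|a - f t| * `|g t| + `|a| * `|b - g t|)) ->
  h @ F --> c.
Proof.
move=> fa gb hb.
have af : (fun t => `|a - f t|) @ F --> (0 : R).
  by rewrite -(normr0 U) -(subrr a); apply: cvg_norm; apply: cvgB => //; exact: cvg_cst.
have bg : (fun t => `|b - g t|) @ F --> (0 : R).
  by rewrite -(normr0 V) -(subrr b); apply: cvg_norm; apply: cvgB => //; exact: cvg_cst.
have : (fun t => C * (`|a - f t| * `|g t| + `|a| * `|b - g t|)) @ F --> (0 : R).
  have -> : (0 : R) = C * (0 * `|b| + `|a| * 0) by rewrite mul0r mulr0 addr0 mulr0.
  apply: cvgM; first exact: cvg_cst.
  apply: cvgD; apply: cvgM => //; [exact: cvg_norm|exact: cvg_cst].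
move=> /cvgrPdist_le rhs; apply/cvgrPdist_le => e /rhs.
apply: filterS2 hb => t h1 h2; apply: (le_trans h1); apply: le_trans h2.
by rewrite sub0r normrN ler_norm.
Qed.

Section Composition.
Context (R : realType).

Definition mk_bop (X : lmodType R) (g : X -> R) (Y : normedModType R) (f : X -> Y)
    (lf : linear f) (C : R) (fC : op_bound g f C) : bop g Y :=
  Bop (introT (asboolP _) (conj lf (ex_intro _ C fC))).

Lemma bopP (X : lmodType R) (g : X -> R) (Y : normedModType R) (A B : bop g Y) :
  (forall x, A x = B x) -> A = B.
Proof. by move=> AB; apply/val_inj/funext. Qed.

Lemma bop_norm_le (X : lmodType R) (g : X -> R) (Y : normedModType R)
    (A : bop g Y) (C : R) :
  0 <= C -> (forall x, `|A x| <= C * g x) -> `|A| <= C.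
Proof. by move=> C0 AC; apply: opnorm_le. Qed.

Lemma le_bop_norm (X : lmodType R) (g : X -> R) (Y : normedModType R)
    (A : bop g Y) x : `|A x| <= `|A| * g x.
Proof. exact: le_opnorm. Qed.

Section BComp.
Context (X : lmodType R) (g : X -> R) (Y Z : normedModType R).
Implicit Types (B : 'L(Y, Z)) (A : bop g Y).

Fact bcomp_linear B A : linear (fun x => B (A x)).
Proof. by move=> a x y; rewrite !linearP. Qed.

Fact bcomp_bound B A : op_bound g (fun x => B (A x)) (`|B| * `|A|).
Proof.
split; first by rewrite mulr_ge0.
by move=> x; rewrite (le_trans (le_bop_norm _ _))// -mulrA ler_wpM2l// le_bop_norm.
Qed.

(** The arbitrary gauge [g] allows the source of [A] to be an interpolation space. *)
Definition bcomp B A : bop g Z := mk_bop (@bcomp_linear B A) (bcomp_bound B A).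

Lemma norm_bcomp B A : `|bcomp B A| <= `|B| * `|A|.
Proof. by apply: bop_norm_le; case: (bcomp_bound B A). Qed.

Fact bcomp_is_bilinear :
  bilinear_for (GRing.Scale.Law.clone _ _ *:%R _) (GRing.Scale.Law.clone _ _ *:%R _)
    bcomp.
Proof.
split=> [A|B] a u v /=; apply: bopP => x //.
by rewrite /= linearP.
Qed.

HB.instance Definition _ := bilinear_isBilinear.Build R 'L(Y, Z) (bop g Y) (bop g Z)
  _ _ bcomp bcomp_is_bilinear.

Lemma bcomp_cvg (T : Type) (F : set_system T) (FF : ProperFilter F)
    (P : T -> 'L(Y, Z)) (Q : T -> bop g Y) B A :
  P @ F --> B -> Q @ F --> A -> (fun t => bcomp (P t) (Q t)) @ F --> bcomp B A.
Proof.
move=> PB QA; apply: (cvg_by_product_bound FF (C := 1) PB QA); apply: nearW => t.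
have -> : bcomp B A - bcomp (P t) (Q t) = bcomp (B - P t) (Q t) + bcomp B (A - Q t).
  by rewrite linearBl linearBr [RHS]addrC subrKA.
by rewrite mul1r (le_trans (ler_normD _ _))// lerD// norm_bcomp.
Qed.

Lemma bcomp_continuous : continuous (fun p => bcomp p.1 p.2).
Proof. by move=> p; apply: bcomp_cvg; [exact: cvg_fst|exact: cvg_snd]. Qed.

Fact lcomp_linear B : linear (bcomp B).
Proof. by move=> a x y; rewrite linearPr. Qed.

Fact lcomp_bound B : op_bound (fun A : bop g Y => `|A|) (bcomp B) `|B|.
Proof. by split=> // A; exact: norm_bcomp. Qed.

Definition lcomp B : 'L(bop g Y, bop g Z) := mk_bop (@lcomp_linear B) (lcomp_bound B).

Fact rcomp_linear A : linear (bcomp^~ A).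
Proof. by move=> a x y; rewrite linearPl. Qed.

Fact rcomp_bound A : op_bound (fun B : 'L(Y, Z) => `|B|) (bcomp^~ A) `|A|.
Proof. by split=> // B; rewrite mulrC norm_bcomp. Qed.

Definition rcomp A : 'L('L(Y, Z), bop g Z) := mk_bop (@rcomp_linear A) (rcomp_bound A).

Lemma lcomp_cvg (T : Type) (F : set_system T) (FF : ProperFilter F)
    (P : T -> 'L(Y, Z)) B : P @ F --> B -> (lcomp \o P) @ F --> lcomp B.
Proof.
move=> PB; apply/cvgrPdist_le => e e0.
move/cvgrPdist_le/(_ _ e0) : PB; apply: filterS => t; apply: le_trans.
apply: bop_norm_le => // A; rewrite -[X in `|X|]/(bcomp B A - bcomp (P t) A).
by rewrite -linearBl norm_bcomp.
Qed.

Lemma rcomp_cvg (T : Type) (F : set_system T) (FF : ProperFilter F)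
    (Q : T -> bop g Y) A : Q @ F --> A -> (rcomp \o Q) @ F --> rcomp A.
Proof.
move=> QA; apply/cvgrPdist_le => e e0.
move/cvgrPdist_le/(_ _ e0) : QA; apply: filterS => t; apply: le_trans.
apply: bop_norm_le => // B; rewrite -[X in `|X|]/(bcomp B A - bcomp B (Q t)).
by rewrite -linearBr mulrC norm_bcomp.
Qed.

End BComp.
End Composition.

Arguments lcomp {R X g Y Z} B.
Arguments rcomp {R X g Y Z} A.

(** * Differential calculus: locality, chain rule, product rule *)

Section Calculus.
Context (R : realType).

(** Regularity is prescribed on open sets only, so identities hold only locally. Both functions
    share one first-order expansion, and the differential is unique. *)
Lemma near_eq_differentiable (X Y : normedModType R) (f g : X -> Y) q :
  (\forall x \near q, f x = g x) -> differentiable f q ->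
  differentiable g q /\ 'd g q = 'd f q :> (X -> Y).
Proof.
move=> fg dfq.
have dfc : continuous ('d f q) by exact: diff_continuous.
have fgq : f q = g q by exact: nbhs_singleton fg.
have gE : g \o shift q = cst (g q) + 'd f q +o_ 0 id.
  have /eqaddoP fE := diff_locally dfq.
  apply/eqaddoP => e e0; have fE' := fE _ e0.
  have fg0 : \forall h \near (0 : X), f (h + q) = g (h + q).
    by move: fg; rewrite (near_shift 0) subr0.
  near=> h; have fgh : f (h + q) = g (h + q) by near: h.
  have : `|(f \o shift q - (cst (f q) + 'd f q)) h| <= e * `|id h| by near: h.
  by rewrite !fctE /= fgh fgq.
have dg := diff_unique dfc gE; split => //.
by apply/diff_locallyP; rewrite dg.
Unshelve. all: by end_near. Qed.

Lemma near_eq_Der (X Y : normedModType R) (f g : X -> Y) q :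
  (\forall x \near q, f x = g x) -> differentiable f q -> Der g q = Der f q.
Proof.
move=> fg df; have [dg dgE] := near_eq_differentiable fg df.
by apply: bopP => x; rewrite (DerE dg) (DerE df) dgE.
Qed.

Lemma near_eq_continuous (T S : topologicalType) (f g : T -> S) q :
  (\forall x \near q, f x = g x) -> {for q, continuous f} -> {for q, continuous g}.
Proof.
move=> fg fq; rewrite /prop_for /continuous_at -(nbhs_singleton fg).
apply: cvg_trans fq; apply: near_eq_cvg.
by move: fg; apply: filterS => x ->.
Qed.

Lemma Der_linear (X Y : normedModType R) (f : {linear X -> Y}) q :
  continuous f -> Der f q = f :> (X -> Y).
Proof.
move=> fc; rewrite (DerE (linear_differentiable _ fc)); exact: diff_lin.
Qed.

Lemma Der_comp (X Y Z : normedModType R) (f : X -> Y) (g : Y -> Z) q :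
  differentiable f q -> differentiable g (f q) ->
  Der (g \o f) q = bcomp (Der g (f q)) (Der f q).
Proof.
move=> df dg; apply: bopP => x; rewrite DerE; last exact: differentiable_comp.
by rewrite diff_comp//= (DerE df) (DerE dg).
Qed.

Lemma C1_continuous (X Y : normedModType R) (U : set X) (f : X -> Y) :
  C1_on U f -> C0_on U f.
Proof. by move=> [df _] q /df; exact: differentiable_continuous. Qed.

Lemma C0_comp (X Y Z : topologicalType) (U : set X) (V : set Y)
    (f : X -> Y) (g : Y -> Z) :
  (forall q, U q -> V (f q)) -> C0_on U f -> C0_on V g -> C0_on U (g \o f).
Proof.
move=> UV cf cg q Uq; apply: continuous_comp; [exact: cf|exact/cg/UV].
Qed.

Lemma near_eq_C0 (X Y : topologicalType) (U : set X) (f g : X -> Y) : open U ->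
  (forall q, U q -> f q = g q) -> C0_on U f -> C0_on U g.
Proof.
move=> oU fg cf q Uq; apply: near_eq_continuous (cf _ Uq).
by apply: filterS fg _; exact: open_nbhs_nbhs.
Qed.

Lemma near_eq_C1 (X Y : normedModType R) (U : set X) (f g : X -> Y) : open U ->
  (forall q, U q -> f q = g q) -> C1_on U f ->
  C1_on U g /\ forall q, U q -> Der g q = Der f q.
Proof.
move=> oU fg [df cf].
have nfg q : U q -> \forall x \near q, f x = g x.
  by move=> Uq; apply: filterS fg _; exact: open_nbhs_nbhs.
have Dfg q : U q -> Der g q = Der f q.
  by move=> Uq; apply: near_eq_Der; [exact: nfg|exact: df].
split; last exact: Dfg.
split=> [q Uq|].
  by have [] := near_eq_differentiable (nfg _ Uq) (df _ Uq).
by apply: (near_eq_C0 oU _ cf) => q Uq; rewrite Dfg.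
Qed.

Lemma C1_comp (X Y Z : normedModType R) (U : set X) (V : set Y)
    (f : X -> Y) (g : Y -> Z) : open U ->
  (forall q, U q -> V (f q)) -> C1_on U f -> C1_on V g -> C1_on U (g \o f).
Proof.
move=> oU UV C1f C1g; have [df cf] := C1f; have [dg cg] := C1g.
split=> [q Uq|]; first by apply: differentiable_comp; [exact: df|exact/dg/UV].
apply: (@near_eq_C0 _ _ U (fun q => bcomp (Der g (f q)) (Der f q))) => // [q Uq|q Uq].
  by rewrite Der_comp//; [exact: df|exact/dg/UV].
apply: bcomp_cvg; last exact: cf.
exact: (C0_comp UV (C1_continuous C1f) cg).
Qed.

Lemma Der_bcomp (X A B C : normedModType R) (P : X -> 'L(B, C)) (Q : X -> 'L(A, B)) q :
  differentiable P q -> differentiable Q q ->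
  differentiable (fun x => bcomp (P x) (Q x)) q /\
  Der (fun x => bcomp (P x) (Q x)) q =
    bcomp (lcomp (P q)) (Der Q q) + bcomp (rcomp (Q q)) (Der P q).
Proof.
move=> dP dQ.
have bc := @bcomp_continuous R A (fun x => `|x|) B C.
have dPQ := differentiable_pair dP dQ.
have db := differentiable_bilin (f := @bcomp R A (fun x => `|x|) B C) (P q, Q q) bc.
have d : differentiable (fun x => bcomp (P x) (Q x)) q.
  exact: (differentiable_comp dPQ db).
split=> //; apply: bopP => x; rewrite (DerE d).
rewrite -[in LHS]/((fun p : 'L(B, C) * 'L(A, B) => bcomp p.1 p.2) \o
  (fun x => (P x, Q x))).
rewrite diff_comp//= diff_pair//= diff_bilin//=.
by rewrite -(DerE dP) -(DerE dQ).
Qed.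

Lemma C1_bcomp (X A B C : normedModType R) (U : set X)
    (P : X -> 'L(B, C)) (Q : X -> 'L(A, B)) : open U ->
  C1_on U P -> C1_on U Q -> C1_on U (fun x => bcomp (P x) (Q x)).
Proof.
move=> oU C1P C1Q; have [dP cP] := C1P; have [dQ cQ] := C1Q.
split=> [q Uq|]; first by have [] := Der_bcomp (dP _ Uq) (dQ _ Uq).
apply: (@near_eq_C0 _ _ U (fun q =>
    bcomp (lcomp (P q)) (Der Q q) + bcomp (rcomp (Q q)) (Der P q))) => // q Uq.
  by have [_ ->] := Der_bcomp (dP _ Uq) (dQ _ Uq).
apply: cvgD; apply: bcomp_cvg.
- exact: lcomp_cvg (C1_continuous C1P Uq).
- exact: cQ.
- exact: rcomp_cvg (C1_continuous C1Q Uq).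
- exact: cP.
Qed.

Lemma C2_comp (X Y Z : normedModType R) (U : set X) (V : set Y)
    (f : X -> Y) (g : Y -> Z) : open U ->
  (forall q, U q -> V (f q)) -> C2_on U f -> C2_on V g ->
  C2_on U (g \o f) /\
  forall q, U q -> forall x y, Der (Der (g \o f)) q x y =
    Der g (f q) (Der (Der f) q x y) + Der (Der g) (f q) (Der f q x) (Der f q y).
Proof.
move=> oU UV [df C1f'] [dg C1g'].
have C1f : C1_on U f by split=> //; exact: C1_continuous.
have DE q : U q -> bcomp (Der g (f q)) (Der f q) = Der (g \o f) q.
  by move=> Uq; rewrite Der_comp//; [exact: df|exact/dg/UV].
have C1gf : C1_on U (Der g \o f) by exact: C1_comp C1g'.
have C1b := C1_bcomp oU C1gf C1f'.
have [C1D DDE] := near_eq_C1 oU DE C1b.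
split=> [|q Uq x y].
  split=> // q Uq; apply: differentiable_comp; [exact: df|exact/dg/UV].
have [df' _] := C1f'; have [dg' _] := C1g'; have [dgf _] := C1gf.
rewrite DDE//; have [_ ->] := Der_bcomp (dgf _ Uq) (df' _ Uq).
have -> : Der (Der g \o f) q = bcomp (Der (Der g) (f q)) (Der f q).
  by apply: Der_comp; [exact: df|exact/dg'/UV].
by [].
Qed.

End Calculus.

(** * Operators on interpolation spaces *)

Lemma compact_embedding_interp (R : realType) (K0 K1 : hilbertType R)
    (i : {linear K1 -> K0}) (s : R) :
  compact_op i -> injective i -> dense (range i) -> 0 <= s -> s < 1 ->
  exists2 C, 0 <= C & forall (A0 : 'L(K0, K0)) (A1 : 'L(K1, K1)),
    (forall x, A0 (i x) = i (A1 x)) ->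
  forall x : interp i s, exists2 y : interp i s,
    interp_val y = A0 (interp_val x) &
    interp_norm y <= C * (`|A0| + `|A1|) * interp_norm x.
Proof.
move=> ci ii di s0 s1; have [e se] := singular_system_exists ci.
have [C C0 CP] := interp_map ci ii di se s0 s1.
exists C => // A0 A1 A01 x; apply: (CP A0 A1) => //.
- by move=> z; rewrite (le_trans (le_bop_norm A0 z))// ler_wpM2r// lerDl.
- by move=> z; rewrite (le_trans (le_bop_norm A1 z))// ler_wpM2r// lerDr.
Qed.

(** [P q] is [T q] composed with the action of [A0 q] on the interpolation space. Continuity in [q]
    comes from the interpolation bound for the differences of [A0] and of [A1]. *)
Lemma interp_precomp_C0 (R : realType) (K0 K1 : hilbertType R)
    (i : {linear K1 -> K0}) (s : R) (Y : normedModType R) (Q : topologicalType)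
    (U : set Q) (A0 : Q -> 'L(K0, K0)) (A1 : Q -> 'L(K1, K1))
    (T : Q -> bop (@interp_norm R K0 K1 i s) Y) :
  compact_op i -> injective i -> dense (range i) -> 0 <= s -> s < 1 -> open U ->
  (forall q, U q -> forall x, A0 q (i x) = i (A1 q x)) ->
  C0_on U A0 -> C0_on U A1 -> C0_on U T ->
  exists P : Q -> bop (@interp_norm R K0 K1 i s) Y,
    C0_on U P /\ forall q, U q -> forall x : interp i s, exists2 y : interp i s,
      interp_val y = A0 q (interp_val x) & P q x = T q y.
Proof.
move=> ci ii di s0 s1 oU A01 cA0 cA1 cT.
have [C C0 CP] := compact_embedding_interp ci ii di s0 s1.
have Sbound q : U q -> forall x y : interp i s,
    interp_val y = A0 q (interp_val x) ->
    interp_norm y <= C * (`|A0 q| + `|A1 q|) * interp_norm x.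
  move=> Uq x y yx; have [y' y'x] := CP _ _ (A01 q Uq) x.
  by have -> : y' = y by apply: val_inj; rewrite /= y'x yx.
have /choice[P PP] : forall q, exists P : bop (@interp_norm R K0 K1 i s) Y,
    U q -> forall x y, interp_val y = A0 q (interp_val x) -> P x = T q y.
  (* Outside [U] the pair need not be compatible with [i], and [P] takes the value 0. *)
  move=> q; have [Uq|nUq] := pselect (U q); last by exists 0.
  have /choice[S SP] : forall x : interp i s, exists y : interp i s,
      interp_val y = A0 q (interp_val x).
    by move=> x; have [y] := CP _ _ (A01 q Uq) x; exists y.
  have lin : linear (fun x => T q (S x)).
    move=> a x y; rewrite -linearP; congr (T q _); apply: val_inj => /=.
    rewrite SP -[interp_val (a *: x + y)]/(a *: interp_val x + interp_val y).
    by rewrite linearP/= -!SP.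
  have bnd : op_bound (@interp_norm R K0 K1 i s) (fun x => T q (S x))
      (`|T q| * (C * (`|A0 q| + `|A1 q|))).
    split=> [|x]; first by rewrite !mulr_ge0// addr_ge0.
    by rewrite (le_trans (le_bop_norm _ _))// -mulrA ler_wpM2l// Sbound.
  exists (mk_bop lin bnd) => _ x y yx /=; congr (T q _).
  by apply: val_inj; rewrite /= SP yx.
exists P; split=> [q Uq|q Uq x]; last first.
  by have [y yx _] := CP _ _ (A01 q Uq) x; exists y => //; exact: PP.
have near_U : \forall t \near q, U t by exact: open_nbhs_nbhs.
have cA : (fun t => (A0 t, A1 t)) @ q --> (A0 q, A1 q).
  exact: (cvg_pair (cA0 _ Uq) (cA1 _ Uq)).
(* The factor 2 compares the sum of the two operator norms with the maximum norm of the pair. *)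
apply: (cvg_by_product_bound _ (C := 2 * C) (cT _ Uq) cA).
apply: filterS near_U => t Ut.
apply: bop_norm_le => [|x].
  by rewrite !mulr_ge0 ?addr_ge0 ?mulr_ge0.
have [yt ytx _] := CP _ _ (A01 t Ut) x; have [yq yqx _] := CP _ _ (A01 q Uq) x.
have dA01 z : (A0 q - A0 t) (i z) = i ((A1 q - A1 t) z).
  by rewrite linearB /= -(A01 q Uq) -(A01 t Ut).
have [yd ydx ydn] := CP (A0 q - A0 t) (A1 q - A1 t) dA01 x.
have ydE : yd = yq - yt by apply: val_inj; rewrite /= ydx yqx ytx.
have -> : (P q - P t) x = (T q - T t) yt + T q yd.
  rewrite -[LHS]/(P q x - P t x) (PP q Uq x yq)// (PP t Ut x yt)//.
  by rewrite -[(T q - T t) yt]/(T q yt - T t yt) ydE linearB /= [RHS]addrC subrKA.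
have tn := Sbound t Ut x yt ytx.
have a0 := normr_ge0 (T q - T t); have b0 := normr_ge0 (T q).
have gx0 : 0 <= interp_norm x by exact: normr_ge0.
rewrite (le_trans (ler_normD _ _))//.
apply: (@le_trans _ _ (`|T q - T t| * (C * (`|A0 t| + `|A1 t|) * interp_norm x) +
   `|T q| * (C * (`|A0 q - A0 t| + `|A1 q - A1 t|) * interp_norm x))).
  apply: lerD; first by rewrite (le_trans (le_bop_norm _ _))// ler_wpM2l.
  by rewrite (le_trans (le_bop_norm _ _))// ler_wpM2l.
have norm2 (a : 'L(K0, K0)) (b : 'L(K1, K1)) : `|a| + `|b| <= 2 * `|(a, b)|.
  by rewrite mulr2n mulrDl !mul1r lerD// prod_normE le_max lexx ?orbT.
have h1 := norm2 (A0 t) (A1 t).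
have h2 : `|A0 q - A0 t| + `|A1 q - A1 t| <= 2 * `|(A0 q, A1 q) - (A0 t, A1 t)|.
  exact: norm2.
set m := `|(A0 t, A1 t)|; set d := `|(A0 q, A1 q) - _|.
rewrite [leRHS](_ : _ = `|T q - T t| * (C * (2 * m) * interp_norm x) +
  `|T q| * (C * (2 * d) * interp_norm x)); last by ring.
by apply: lerD; rewrite ler_wpM2l// ler_wpM2r// ler_wpM2l.
Qed.

Lemma compact_op_continuous (R : realType) (K0 K1 : hilbertType R)
    (i : {linear K1 -> K0}) : compact_op i -> continuous i.
Proof.
move=> /compact_op_bounded[C C0 iC] q; apply/cvgrPdist_le => e e0.
have d0 : 0 < e / C by rewrite divr_gt0.
have : (fun x : K1 => x) @ q --> q by exact: cvg_id.
move/cvgrPdist_le/(_ _ d0); apply: filterS => x qx.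
by rewrite -linearB (le_trans (iC _))// mulrC -ler_pdivlMr.
Qed.

(** * Assembling the extended derivatives of the composition *)

Theorem proposition2p9 (R : realType) (H0 H1 H2 : hilbertType R)
    (i1 : {linear H1 -> H0}) (i2 : {linear H2 -> H1})
    (triple : hilbert_triple i1 i2)
    (Hm1 : completeNormedModType R) (j : {linear H0 -> Hm1})
    (completion : negative_completion i1 j)
    (s : R) (s_ge0 : 0 <= s) (s_lt1 : s < 1)
    (U V W : set H1) (openU : open U) (openV : open V) (openW : open W)
    (phi psi : H1 -> H1)
    (floer_phi : s_floer i1 i2 j s U V phi)
    (floer_psi : s_floer i1 i2 j s V W psi) :
  s_floer i1 i2 j s U W (psi \o phi).
Proof.
have [[inj1 inj2] [dense1 dense2] [cpt1 cpt2]] := triple.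
have [[UV C2phi [phi2 [phi2E C2phi2]]] [D [D2 [Dm [D2m [f1 f2]]]]]] := floer_phi.
have [DE C1D D2E C0D2] := f1; have [DmE C1Dm D2mE C0D2m] := f2.
have [[VW C2psi [psi2 [psi2E C2psi2]]] [E [E2 [Em [E2m [g1 g2]]]]]] := floer_psi.
have [EE C1E E2E C0E2] := g1; have [EmE C1Em E2mE C0E2m] := g2.
have i2c := compact_op_continuous cpt2.
set U2 := i2 @^-1` U; set V2 := i2 @^-1` V.
have openU2 : open U2 by apply: open_comp => // q _; exact: i2c.
have UV2 q : U2 q -> V2 (phi2 q).
  by move=> Uq; rewrite /V2/= phi2E//; exact: UV.
have [C2chi DDE] := C2_comp openU UV C2phi C2psi.
have [C2chi2 _] := C2_comp openU2 UV2 C2phi2 C2psi2.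
have [dphi C1dphi] := C2phi; have [dpsi C1dpsi] := C2psi.
have [dphi2 C1dphi2] := C2phi2.
have C1phi : C1_on U phi by split=> //; exact: C1_continuous.
have C1phi2 : C1_on U2 phi2 by split=> //; exact: C1_continuous.
have C0phi : C0_on U phi := C1_continuous C1phi.
have C0phi2 : C0_on U2 phi2 := C1_continuous C1phi2.
(* Differentiating [i2 \o phi2 = phi \o i2] makes the derivatives on [H1] and [H2] a compatible
   pair, as interpolation along [i2] requires. *)
have Dphi2 q : U2 q -> forall x, Der phi (i2 q) (i2 x) = i2 (Der phi2 q x).
  move=> Uq x.
  have di2 y : differentiable i2 y by apply: linear_differentiable; exact: i2c.
  have near_phi : \forall y \near q, (i2 \o phi2) y = (phi \o i2) y.
    by apply: filterS phi2E _; exact: open_nbhs_nbhs.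
  have := near_eq_Der near_phi (differentiable_comp (dphi2 _ Uq) (di2 _)).
  rewrite (Der_comp (di2 _) (dphi _ Uq)) (Der_comp (dphi2 _ Uq) (di2 _)).
  by move=> /(congr1 (fun A : 'L(H2, H1) => A x)) /=; rewrite !(Der_linear _ i2c).
(* [P q] is the second derivative of [psi] at [phi q] with the derivative of [phi] inserted in its
   first argument only; [Pm] below is its analogue on the upper level. *)
have [P [C0P PE]] := interp_precomp_C0 cpt1 inj1 dense1 s_ge0 s_lt1 openU DE
  (C1_continuous C1D) (C1_continuous C1dphi) (C0_comp UV C0phi C0E2).
have i2U2 q : U2 q -> U (i2 q) by [].
have C0i2 : C0_on U2 i2 by move=> q _; exact: i2c.
have [Pm [C0Pm PmE]] := interp_precomp_C0 cpt2 inj2 dense2 s_ge0 s_lt1 openU2 Dphi2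
  (C0_comp i2U2 C0i2 (C1_continuous C1dphi)) (C1_continuous C1dphi2)
  (C0_comp UV2 C0phi2 C0E2m).
split.
  split=> //; first by move=> q /UV /VW.
  exists (psi2 \o phi2); split=> // q Uq /=.
  by rewrite psi2E ?phi2E//; exact: UV.
exists (fun q => bcomp (E (phi q)) (D q)).
(* Here [rcomp (D q)] inserts the derivative of [phi] in the second argument, and [lcomp] applies
   that of [psi] to the value. *)
exists (fun q => bcomp (rcomp (D q)) (P q) + bcomp (lcomp (E (phi q))) (D2 q)).
exists (fun q => bcomp (Em (phi2 q)) (Dm q)).
exists (fun q => bcomp (rcomp (Dm q)) (Pm q) + bcomp (lcomp (Em (phi2 q))) (D2m q)).
have C1Ephi : C1_on U (E \o phi) := C1_comp openU UV C1phi C1E.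
have C1Emphi2 : C1_on U2 (Em \o phi2) := C1_comp openU2 UV2 C1phi2 C1Em.
split; split.
- move=> q Uq xi /=; rewrite DE// EE; last exact: UV.
  by rewrite (Der_comp (dphi _ Uq) (dpsi _ (UV _ Uq))).
- exact: (C1_bcomp openU C1Ephi C1D).
- move=> q Uq xi eta x xE.
  have [y yE Py] := PE q Uq x.
  rewrite DDE//.
  rewrite -[LHS]/(P q x (D q (i1 eta)) + E (phi q) (D2 q x (i1 eta))).
  rewrite Py (D2E q Uq xi eta x xE) DE// EE; last exact: UV.
  (* For [x] coming from [H1], the vector [y] also comes from [H1], so the extension property of
     [E2] applies to it. *)
  rewrite xE DE// in yE.
  by rewrite (E2E _ (UV _ Uq) _ _ _ yE) linearD addrC.
- move=> q Uq; apply: cvgD; apply: bcomp_cvg.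
  + exact: rcomp_cvg (C1_continuous C1D Uq).
  + exact: C0P.
  + exact: lcomp_cvg (C1_continuous C1Ephi Uq).
  + exact: C0D2.
- move=> q Uq eta /=; rewrite DmE// EmE; last exact: UV2.
  by rewrite phi2E.
- exact: (C1_bcomp openU2 C1Emphi2 C1Dm).
- move=> q Uq x x' eta x'E.
  have [y yE Pmy] := PmE q Uq x; have [y' y'E Py'] := PE (i2 q) Uq x'.
  change (Pm q x (Dm q (j eta)) + Em (phi2 q) (D2m q x (j eta)) =
    j (P (i2 q) x' (D (i2 q) eta) + E (phi (i2 q)) (D2 (i2 q) x' eta))).
  rewrite Pmy Py' (D2mE q Uq x x' eta x'E) DmE// EmE; last exact: UV2.
  (* The two interpolated images of the same vector agree in [H0], as needed to compare [E2m] with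
     [E2]. *)
  have y'y : interp_val y' = i1 (interp_val y) by rewrite y'E yE x'E DE.
  by rewrite (E2mE _ (UV2 _ Uq) _ _ _ y'y) phi2E// linearD.
- move=> q Uq; apply: cvgD; apply: bcomp_cvg.
  + exact: rcomp_cvg (C1_continuous C1Dm Uq).
  + exact: C0Pm.
  + exact: lcomp_cvg (C1_continuous C1Emphi2 Uq).
  + exact: C0D2m.
Qed.
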